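(* Let $m\ge 1$ and let $\{(N_j, B_j, L_j): 1 \le j \le m\}$ be finitely many Hadamard triples in $\mathbb{R}$. Suppose that $\gcd(B_j - B_j) = 1$ for $1\le j \le m$. Let $\{n_k\}_{k=1}^\infty$ be a sequence of positive integers. For $\omega=(\omega_k)_{k=1}^\infty \in \Omega = \{1,2,\dots,m\}^{\mathbb{N}}$ let $\mu_{\omega,\{n_k\}}$ be the infinite convolution $$\mu_{\omega,\{n_k\}} = \delta_{N_{\omega_1}^{-n_1} B_{\omega_1}} * \delta_{N_{\omega_1}^{-n_1} N_{\omega_2}^{-n_2} B_{\omega_2}} * \cdots * \delta_{N_{\omega_1}^{-n_1} N_{\omega_2}^{-n_2} \cdots N_{\omega_k}^{-n_k} B_{\omega_k} }* \cdots .$$ Then $\mu_{\omega,\{n_k\}}$ is a spectral measure for every $\omega \in \Omega$.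
   Context: A Hadamard triple in $\mathbb{R}$ is a triple $(N,B,L)$ where $N\in\mathbb{Z}$ with $|N|\ge 2$, and $B,L\subseteq\mathbb{Z}$ are finite sets with $\#B=\#L\ge 2$ such that the matrix $\left[\frac{1}{\sqrt{\#B}}\, e^{-2\pi i b\ell/N}\right]_{b\in B,\ \ell\in L}$ is unitary. For a finite set $B\subseteq\mathbb{Z}$, $B-B=\{b-b': b,b'\in B\}$, and $\gcd(B-B)$ is the greatest common divisor of the elements of this set. For a finite nonempty set $A\subseteq\mathbb{R}$, $\delta_A=\frac{1}{\#A}\sum_{a\in A}\delta_a$, where $\delta_a$ is the Dirac measure at $a$; for a real number $c$, $cA=\{ca:a\in A\}$. An infinite convolution denotes the weak limit of the finite partial convolutions (in the present setting this weak limit exists and is a Borel probability measure with compact support). A Borel probability measure $\mu$ on $\mathbb{R}$ is a spectral measure if there is a countable set $\Lambda\subseteq\mathbb{R}$ such that the family of exponentials $\{e_\lambda(x)=e^{2\pi i\lambda x}:\lambda\in\Lambda\}$ forms an orthonormal basis of $L^2(\mu)$. *)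

(* Defs.v *)
From HB Require Import structures.
From mathcomp Require Import all_boot all_order all_algebra finmap.
From mathcomp Require Import all_classical all_reals all_analysis.
From mathcomp Require Import spectral complex.

Set Implicit Arguments.
Unset Strict Implicit.
Unset Printing Implicit Defensive.

Import Order.TTheory GRing.Theory Num.Theory.
Import numFieldNormedType.Exports.
Import ComplexField.Normc.

Local Open Scope classical_set_scope.
Local Open Scope ring_scope.
Local Open Scope complex_scope.

(* e^{it} *)
Definition expi {R : realType} (t : R) : R[i] := cos t +i* sin t.

Section Hadamard.
Variable R : realType.

Definition hadamard_mx (N : int) (B L : {fset int}) :
    'M[R[i]]_(#|` B|, #|` L|) :=
  \matrix_(i, j)
    ((Num.sqrt #|` B|%:R)^-1%:C *
     expi (- (2 * pi * (B`_i)%:~R * (L`_j)%:~R / N%:~R))).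

(* [unitarymx] also makes sense for rectangular matrices, where it only asks
   for M *m M^t* = 1; here the matrix is square because #B = #L. *)
Definition hadamard_triple (N : int) (B L : {fset int}) : Prop :=
  [/\ 2 <= `|N|, #|` B| = #|` L|, (2 <= #|` B|)%N
    & hadamard_mx N B L \is unitarymx].

End Hadamard.

Definition diff_fset (B : {fset int}) : {fset int} :=
  [fset b - b' | b in B, b' in B]%fset.

Definition gcd_fset (A : {fset int}) : int := \big[gcdz/0]_(a <- A) a.

Section Measures.
Variable R : realType.

(* delta_A, for A nonempty; it is the zero measure if A is empty. *)
Definition unif_dirac (A : {fset R}) (S : set R) : \bar R :=
  ((#|` A|%:R^-1)%:E * \sum_(a <- A) \d_a S)%E.

Section unif_dirac_measure.
Variable A : {fset R}.

Let nu : {measure set R -> \bar R} :=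
  mscale (#|` A|%:R^-1)%:nng
    (msum (fun k => \d_(A`_k) : {measure set R -> \bar R}) #|` A|).

Let unif_diracE : unif_dirac A = nu.
Proof.
apply/funext => S; rewrite /unif_dirac /nu /= /mscale /= /msum.
by rewrite (big_nth 0) big_mkord.
Qed.

Let unif_dirac0 : unif_dirac A set0 = 0%E.
Proof. by rewrite unif_diracE measure0. Qed.

Let unif_dirac_ge0 S : (0 <= unif_dirac A S)%E.
Proof. by rewrite unif_diracE measure_ge0. Qed.

Let unif_dirac_additive : semi_sigma_additive (unif_dirac A).
Proof. by rewrite unif_diracE; exact: measure_semi_sigma_additive. Qed.

HB.instance Definition _ := isMeasure.Build _ _ _ (unif_dirac A)
  unif_dirac0 unif_dirac_ge0 unif_dirac_additive.

Let unif_dirac_fin : fin_num_fun (unif_dirac A).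
Proof.
move=> S _; rewrite /unif_dirac; under eq_bigr do rewrite diracE.
by rewrite sumEFin.
Qed.

HB.instance Definition _ := Measure_isFinite.Build _ _ _ (unif_dirac A)
  unif_dirac_fin.

End unif_dirac_measure.

(* Image of the product measure under addition. *)
Definition convolution (mu nu : set R -> \bar R) : set R -> \bar R :=
  pushforward (mu \x nu)%E (fun p : R * R => p.1 + p.2).

Section convolution_measure.
Variables mu nu : {finite_measure set R -> \bar R}.

Let add_meas : measurable_fun [set: R * R] (fun p : R * R => p.1 + p.2).
Proof. exact: measurable_realfun.measurable_funD. Qed.

Let conv0 : convolution mu nu set0 = 0%E.
Proof. exact: measure0. Qed.

Let conv_ge0 S : (0 <= convolution mu nu S)%E.
Proof. exact: measure_ge0. Qed.

Let conv_additive : semi_sigma_additive (convolution mu nu).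
Proof. exact: measure_semi_sigma_additive. Qed.

HB.instance Definition _ := isMeasure.Build _ _ _ (convolution mu nu)
  conv0 conv_ge0 conv_additive.

Let conv_fin : fin_num_fun (convolution mu nu).
Proof.
apply: lty_fin_num_fun; change ((mu \x nu)%E [set: R * R] < +oo)%E.
by rewrite -setXTT product_measure1E// lte_mul_pinfty// ?fin_num_measure//
  -ge0_fin_numE// fin_num_measure.
Qed.

HB.instance Definition _ := Measure_isFinite.Build _ _ _ (convolution mu nu)
  conv_fin.

End convolution_measure.

(* Partial convolution delta_(A 0) * ... * delta_(A k). *)
Fixpoint partial_convolution (A : nat -> {fset R}) (k : nat) :
    {finite_measure set R -> \bar R} :=
  if k is k'.+1
  then convolution (partial_convolution A k') (unif_dirac (A k))
  else unif_dirac (A 0).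

Definition weak_cvg (mu_ : nat -> {finite_measure set R -> \bar R})
    (mu : {finite_measure set R -> \bar R}) : Prop :=
  forall f : R -> R, continuous f -> bounded_fun f ->
    (\int[mu_ k]_x (f x)%:E @[k --> \oo] --> \int[mu]_x (f x)%:E)%E.

Definition is_infinite_convolution (A : nat -> {fset R})
    (mu : probability R R) : Prop :=
  weak_cvg (partial_convolution A) mu.

End Measures.

(* The Hilbert space of complex-valued square-integrable functions. The
   library's Lebesgue integral and its L^p norms only take (extended) real
   values. *)
Section ComplexL2.
Variables (R : realType) (mu : probability R R).

Definition cmeasurable (f : R -> R[i]) : Prop :=
  measurable_fun setT (fun x => complex.Re (f x)) /\
  measurable_fun setT (fun x => complex.Im (f x)).

Definition cintegral (f : R -> R[i]) : R[i] :=
  Rintegral mu setT (fun x => complex.Re (f x)) +i*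
  Rintegral mu setT (fun x => complex.Im (f x)).

Definition L2norm (f : R -> R[i]) : \bar R :=
  ('N[mu]_2%:E[(fun x => (normc (f x))%:E)])%E.

Definition inL2 (f : R -> R[i]) : Prop :=
  cmeasurable f /\ (L2norm f < +oo)%E.

Definition L2inner (f g : R -> R[i]) : R[i] :=
  cintegral (fun x => f x * (g x)^*).

(* An orthonormal basis is an orthonormal family whose linear span is dense. *)
Definition orthonormal_basis (I : choiceType) (D : set I)
    (e : I -> R -> R[i]) : Prop :=
  [/\ forall i, D i -> inL2 (e i),
      forall i j, D i -> D j -> L2inner (e i) (e j) = (i == j)%:R
    & forall f : R -> R[i], inL2 f -> forall eps : R, 0 < eps ->
        exists (s : {fset I}) (c : I -> R[i]),
          [set` s] `<=` D /\
          (L2norm (fun x => f x - \sum_(i <- s) c i * e i x)%R < eps%:E)%E].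

End ComplexL2.

Section Spectral.
Variable R : realType.

Definition exponential (lambda x : R) : R[i] := expi (2 * pi * lambda * x).

Definition spectral_measure (mu : probability R R) : Prop :=
  exists Lambda : set R,
    countable Lambda /\ orthonormal_basis mu Lambda exponential.

End Spectral.

Section MoranSets.
Variables (R : realType) (m : nat) (N : 'I_m -> int) (B : 'I_m -> {fset int}).
Variables (n : nat -> nat) (omega : nat -> 'I_m).

(* The sequences n and omega are indexed from 0: digit_set 0 is
   N_(omega 0)^-(n 0) B_(omega 0). *)
Definition digit_set (k : nat) : {fset R} :=
  [fset (\prod_(i < k.+1) (N (omega i))%:~R ^- n i) * b%:~R
    | b in B (omega k)]%fset.

End MoranSets.

(* Main.v *)
(* Let q_B(t) = |1/#B sum_(b in B) e(b t)|^2. The squared Fourier transform of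
   the tail of the infinite convolution after k factors is a product of masks
   q_B, and spectrality follows once the tails are uniformly "equi-positive":
   there is e > 0 such that for each tail every real x has an integer translate
   x + p at which that tail is >= e. Given this, a spectrum is grown one factor at a time: a
   frequency l already chosen is kept, and each new frequency l + P_k j,
   j in L, is moved by a multiple of P_(k+1) to a place where the next tail is
   >= e; the bound persists for all later tails because each is a factor of
   the previous one. Bounds from below by e turn the Parseval identities of the
   partial convolutions into that of the limit, by dominated convergence.

   Equi-positivity is a counting argument. Spell N^n B as n letters with base N
   and digit sets {0}, ..., {0}, B, so that only finitely many letters occur.
   If x is not an integer, the Hadamard condition and gcd(B - B) = 1 give at
   least two nonzero branches at every step, hence 2^k integers 0 <= p < P_k at
   which the first k factors do not vanish. At each of the next j levels at
   most d of them are lost, d being the maximal degree of a mask, and after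
   these the argument is within 2^-j of 0, where the remaining tail is >= 1/2.
   Choosing 2^k > d j leaves a survivor; compactness of [0, 1] and the finite
   number of words of length k + j make the bound uniform. *)

Require Import Defs.
From HB Require Import structures.
From mathcomp Require Import all_boot all_order all_algebra finmap.
From mathcomp Require Import all_classical all_reals all_analysis.
From mathcomp Require Import measurable_realfun spectral complex.
From mathcomp Require Import zify ring lra.

Set Implicit Arguments.
Unset Strict Implicit.
Unset Printing Implicit Defensive.

Import Order.TTheory GRing.Theory Num.Theory.
Import numFieldNormedType.Exports.
Import ComplexField.Normc.

Local Open Scope classical_set_scope.
Local Open Scope ring_scope.
Local Open Scope complex_scope.

(** * Products of masks along words of finitely many letters *)

Section Words.
Variables (R : realType) (I : finType) (N : I -> nat) (q : I -> R -> R).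
Implicit Types (a : nat -> I) (k : nat) (x y : R).

Definition denom a k : nat := \prod_(i < k) N (a i).

(** When each q c is the squared Fourier transform of a digit measure, this is the squared Fourier
    transform of the convolution of the first k rescaled digit measures. *)
Definition mask_prod a k x : R :=
  \prod_(i < k) q (a i) (x / (denom a i.+1)%:R).

Definition shift_seq (T : Type) (a : nat -> T) k : nat -> T := fun i => a (k + i)%N.

Lemma denom_split a k j :
  denom a (k + j) = (denom a k * denom (shift_seq a k) j)%N.
Proof. by rewrite /denom big_split_ord. Qed.

Lemma mask_prod_split a k j x : mask_prod a (k + j) x =
  mask_prod a k x * mask_prod (shift_seq a k) j (x / (denom a k)%:R).
Proof.
rewrite /mask_prod big_split_ord; congr (_ * _); apply: eq_bigr => i _ /=.
by rewrite -addnS denom_split natrM invfM mulrA.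
Qed.

Lemma mask_prodS a k x :
  mask_prod a k.+1 x = mask_prod a k x * q (a k) (x / (denom a k.+1)%:R).
Proof. by rewrite /mask_prod big_ord_recr. Qed.

Lemma denomS a k : denom a k.+1 = (denom a k * N (a k))%N.
Proof. by rewrite /denom big_ord_recr. Qed.

Lemma eq_mask_prod a b k x : (forall i, (i < k)%N -> a i = b i) ->
  mask_prod a k x = mask_prod b k x.
Proof.
move=> ab; rewrite /mask_prod; apply: eq_bigr => i _; rewrite ab//.
congr (q _ (_ / _%:R)); rewrite /denom; apply: eq_bigr => j _; rewrite ab//.
by rewrite (leq_trans (ltn_ord j)).
Qed.

Hypothesis N_ge2 : forall i, (2 <= N i)%N.

Lemma denom_ge a k : (2 ^ k <= denom a k)%N.
Proof.
elim: k => [|k IH]; first by rewrite /denom big_ord0.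
by rewrite denomS expnSr leq_mul.
Qed.

Lemma denom_gt0 a k : (0 < denom a k)%N.
Proof. by rewrite (leq_trans _ (denom_ge a k))// expn_gt0. Qed.

Lemma denomR_gt0 a k : 0 < (denom a k)%:R :> R.
Proof. by rewrite ltr0n denom_gt0. Qed.

Hypothesis q_ge0 : forall i x, 0 <= q i x.
Hypothesis q_le1 : forall i x, q i x <= 1.
Hypothesis q0 : forall i, q i 0 = 1.
Hypothesis q_periodic : forall i x (z : int), q i (x + z%:~R) = q i x.
Variable C : R.
Hypothesis C_ge0 : 0 <= C.
Hypothesis q_lip : forall i x y, `|q i x - q i y| <= C * `|x - y|.

Lemma mask_prod_ge0 a k x : 0 <= mask_prod a k x.
Proof. by apply: prodr_ge0. Qed.

Lemma mask_prod_le1 a k x : mask_prod a k x <= 1.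
Proof. by apply: prodr_ile1 => i _; rewrite q_ge0 q_le1. Qed.

Lemma mask_prod_at0 a k : mask_prod a k 0 = 1.
Proof. by rewrite /mask_prod big1// => i _; rewrite mul0r q0. Qed.

Lemma mask_prod_nonincr a k j x : mask_prod a (k + j) x <= mask_prod a k x.
Proof. by rewrite mask_prod_split ler_piMr// ?mask_prod_ge0 ?mask_prod_le1. Qed.

(** Every [denom a i.+1] with i < k divides [denom a k], so each factor is shifted by an integer. *)
Lemma mask_prod_periodic a k x (z : int) :
  mask_prod a k (x + z%:~R * (denom a k)%:R) = mask_prod a k x.
Proof.
apply: eq_bigr => i _.
have [M ->] : exists M, denom a k = (denom a i.+1 * M)%N.
  by rewrite -{1}(subnKC (ltn_ord i)) denom_split; eexists.
have D0 : (denom a i.+1)%:R != 0 :> R by rewrite gt_eqF// denomR_gt0.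
rewrite -[in RHS](q_periodic (a i) _ (z * M%:Z)); congr q.
by rewrite natrM intrM; field.
Qed.

(** The constant does not grow with k: by the product rule the first letter and the remaining word
    each contribute at most C |x - y| / N, and N >= 2. *)
Lemma mask_prod_lip a k x y :
  `|mask_prod a k x - mask_prod a k y| <= C * `|x - y|.
Proof.
elim: k a x y => [|k IH] a x y.
  by rewrite /mask_prod !big_ord0 subrr normr0 mulr_ge0.
rewrite -[k.+1]add1n !mask_prod_split.
have D1 : denom a 1 = N (a 0%N) by rewrite /denom big_ord1.
rewrite {1 3}/mask_prod !big_ord1/= !D1.
set n := (N (a 0%N))%:R; set b := shift_seq _ _.
have n_ge2 : 2 <= n :> R by rewrite ler_nat.
have n_gt0 : 0 < n by apply: lt_le_trans n_ge2.
have h1 := q_lip (a 0%N) (x / n) (y / n).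
have h2 := IH b (x / n) (y / n).
have h3 : `|x / n - y / n| <= `|x - y| / 2.
  rewrite -mulrBl normrM normfV (gtr0_norm n_gt0) ler_wpM2l//.
  by rewrite lef_pV2// posrE.
set u := q _ _ in h1 *; set u' := q _ _ in h1 *.
set v := mask_prod _ _ _ in h2 *; set v' := mask_prod _ _ _ in h2 *.
have -> : u * v - u' * v' = (u - u') * v + u' * (v - v') by ring.
apply: le_trans (ler_normD _ _) _; rewrite !normrM.
have v1 : `|v| <= 1 by rewrite ger0_norm ?mask_prod_le1 ?mask_prod_ge0.
have u1 : `|u'| <= 1 by rewrite ger0_norm ?q_le1 ?q_ge0.
have h4 : `|u - u'| * `|v| <= C * (`|x - y| / 2).
  rewrite -[leRHS]mulr1 ler_pM//; apply: le_trans h1 _.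
  by rewrite ler_wpM2l.
have h5 : `|u'| * `|v - v'| <= C * (`|x - y| / 2).
  rewrite -[leRHS]mul1r ler_pM//; apply: le_trans h2 _.
  by rewrite ler_wpM2l.
lra.
Qed.


(** * Branching and equi-positivity *)

Definition is_integer x := exists z : int, x = z%:~R.

Hypothesis q_two : forall i x, ~ is_integer x -> exists l l' : nat,
  [/\ (l < l')%N, (l' < N i)%N, q i ((x + l%:R) / (N i)%:R) != 0
    & q i ((x + l'%:R) / (N i)%:R) != 0].

Lemma not_integer_div x (p k : nat) : (0 < k)%N ->
  ~ is_integer x -> ~ is_integer ((x + p%:R) / k%:R).
Proof.
move=> k0 xNZ [z zE]; apply: xNZ; exists (z * k%:Z - p%:Z).
have k0' : k%:R != 0 :> R by rewrite pnatr_eq0 -lt0n.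
by rewrite intrB intrM -zE -!pmulrn divfK// addrK.
Qed.

(** The two nonzero branches of the next letter at (x + p) / [denom a k], which is again not an
    integer, extend p by multiples of [denom a k]; by periodicity these leave the first k factors
    unchanged. *)
Lemma mask_prod_branching a k x : ~ is_integer x -> exists s : seq nat,
  [/\ uniq s, size s = (2 ^ k)%N
    & forall p, p \in s -> (p < denom a k)%N /\ mask_prod a k (x + p%:R) != 0].
Proof.
move=> xNZ; elim: k => [|k [s [us ss hs]]].
  exists [:: 0%N]; split => // p; rewrite inE => /eqP ->.
  by rewrite /denom /mask_prod !big_ord0; split => //; exact: oner_neq0.
have D0 := denom_gt0 a k.
pose y (p : nat) := (x + p%:R) / (denom a k)%:R.
have yNZ p : ~ is_integer (y p) by apply: not_integer_div.
have /choice[f hf] : forall p, exists l : nat * nat,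
  [/\ (l.1 < l.2)%N, (l.2 < N (a k))%N, q (a k) ((y p + l.1%:R) / (N (a k))%:R) != 0
    & q (a k) ((y p + l.2%:R) / (N (a k))%:R) != 0].
  by move=> p; have [l [l' ?]] := q_two (a k) (yNZ p); exists (l, l').
have hl p l : p \in s -> (l < N (a k))%N ->
    q (a k) ((y p + l%:R) / (N (a k))%:R) != 0 ->
    (p + denom a k * l < denom a k.+1)%N /\
    mask_prod a k.+1 (x + (p + denom a k * l)%:R) != 0.
  move=> /hs[pD qp] lN ql; split.
    by rewrite denomS; apply: leq_trans (leq_mul (leqnn _) lN); rewrite mulnS ltn_add2r.
  rewrite mask_prodS mulf_neq0//.
    rewrite natrD natrM addrA [_%:R * _]mulrC.
    by rewrite -[l%:R]/(l%:Z%:~R) mask_prod_periodic.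
  move: ql; congr (q _ _ != 0); rewrite /y denomS !natrD !natrM.
  have ? : (N (a k))%:R != 0 :> R by rewrite pnatr_eq0 -lt0n ltnW ?N_ge2.
  have ? : (denom a k)%:R != 0 :> R by rewrite gt_eqF// denomR_gt0.
  by field; exact/andP.
pose g1 p := (p + denom a k * (f p).1)%N; pose g2 p := (p + denom a k * (f p).2)%N.
(* Reduction modulo [denom a k] recovers p, whence g1 and g2 are injective on s; a common value
   would moreover force the two branches to coincide. *)
have gE p l : p \in s -> ((p + denom a k * l) %% denom a k)%N = p.
  by move=> /hs[pD _]; rewrite mulnC addnC modnMDl modn_small.
exists (map g1 s ++ map g2 s); split.
- rewrite cat_uniq !map_inj_in_uniq ?us ?andbT/=.
  + apply/hasPn => _ /mapP[p ps ->]; apply/negP => /mapP[p' ps'].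
    move=> e; have := e; move=> /(congr1 (fun u => u %% denom a k)%N).
    rewrite !gE// => pp'; move: e; rewrite /g1 /g2 pp' => /addnI/eqP.
    rewrite eqn_pmul2l// => /eqP e; have [] := hf p'.
    by rewrite e ltnn.
  + by move=> p p' ps ps' /(congr1 (fun u => u %% denom a k)%N); rewrite !gE.
  + by move=> p p' ps ps' /(congr1 (fun u => u %% denom a k)%N); rewrite !gE.
- by rewrite size_cat !size_map ss expnS mul2n addnn.
- move=> ?; rewrite mem_cat => /orP[] /mapP[p' ps ->]; have [h1 h2 h3 h4] := hf p'.
  + by apply: hl => //; apply: ltn_trans h1 h2.
  + exact: hl.
Qed.

Variable d : nat.
Hypothesis q_zeros : forall i (s : seq R), uniq s ->
  (forall t, t \in s -> 0 <= t < 1 /\ q i t = 0) -> (size s <= d)%N.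

(* Beyond level k the points (x + p) / denom lie in [0, 1[, so each further
   level discards at most d of the 2 ^ k survivors. *)
Lemma mask_prod_survivor a k j x : 0 < x < 1 -> (d * j < 2 ^ k)%N ->
  exists p, (p < denom a k)%N /\ mask_prod a (k + j) (x + p%:R) != 0.
Proof.
move=> /andP[x0 x1] djk.
have xNZ : ~ is_integer x.
  case=> z zE; move: x0 x1; rewrite zE ltr0z -[1]/(1%:~R) ltr_int.
  by lia.
have [s [us ss hs]] := mask_prod_branching a k xNZ.
apply: contrapT => /forallNP nex.
(* [Z i] holds the candidates lost at level k + i; if none survived, these sets would cover s. *)
pose Z i := [seq p <- s | q (a (k + i)%N) ((x + p%:R) / (denom a (k + i).+1)%:R) == 0].
suff : (size s <= d * j)%N by rewrite ss leqNgt djk.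
have sub : {subset s <= flatten [seq Z i | i <- iota 0 j]}.
  move=> p ps; have [pD qp] := hs _ ps.
  have /not_andP[//|/negP] := nex p.
  rewrite negbK mask_prod_split mulf_eq0 (negbTE qp)/= prodf_seq_eq0.
  move=> /hasP[i _ /= qi]; apply/flattenP; exists (Z i).
    by apply: map_f; rewrite mem_iota/=.
  rewrite mem_filter ps andbT; move: qi; congr (q _ _ == 0).
  by rewrite -addnS denom_split natrM invfM mulrA.
apply: leq_trans (uniq_leq_size us sub) _.
rewrite size_flatten /shape -map_comp sumnE big_map mulnC -[X in (X * d)%N](size_iota 0 j).
rewrite -sum1_size big_distrl/=.
apply: leq_sum => i _ /=; rewrite mul1n.
rewrite -(size_map (fun p : nat => (x + p%:R) / (denom a (k + i).+1)%:R : R)).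
apply: (q_zeros (i := a (k + i)%N)).
  rewrite map_inj_uniq ?filter_uniq// => p p'.
  move/(divIf _); rewrite gt_eqF ?denomR_gt0// => /(_ isT)/addrI/eqP.
  by rewrite eqr_nat => /eqP.
move=> _ /mapP[p + ->]; rewrite mem_filter => /andP[/eqP qp ps]; split => //.
have xp0 : 0 <= x + p%:R by rewrite addr_ge0// ltW.
rewrite divr_ge0//=.
rewrite ltr_pdivrMr ?denomR_gt0// mul1r.
have [pD _] := hs _ ps.
have pD' : (p.+1 <= denom a (k + i).+1)%N.
  rewrite -addnS denom_split (leq_trans pD)// leq_pmulr// denom_gt0//.
by apply: lt_le_trans (_ : p.+1%:R <= _); rewrite ?ler_nat// -natr1 addrC ltrD2l.
Qed.


Lemma continuous_mask_prod a k : continuous (mask_prod a k).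
Proof.
move=> x; apply/cvgrPdist_lt => e e0.
have C1 : 0 < C + 1 by rewrite ltr_wpDl.
have d0 : 0 < e / (C + 1) by rewrite divr_gt0.
near=> y.
apply: le_lt_trans (mask_prod_lip a k x y) _.
apply: le_lt_trans (_ : (C + 1) * `|x - y| < _).
  by rewrite ler_wpM2r// lerDl.
by rewrite mulrC -ltr_pdivlMr//; near: y; apply: cvgr_dist_lt d0.
Unshelve. all: by end_near. Qed.

(** The sum of all the translates is continuous and positive on [0, 1]; it attains a positive
    minimum, and some term reaches its share of it. *)
Lemma mask_prod_bounded_below a k j : (d * j < 2 ^ k)%N ->
  exists2 e : R, 0 < e & forall x, 0 <= x <= 1 -> exists p : int,
    `|x + p%:~R| <= (denom a k)%:R /\ e <= mask_prod a (k + j) (x + p%:~R).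
Proof.
move=> djk; set D := denom a k.
have D0 : (0 < D)%N by apply: denom_gt0.
(* The offset -1 lets p = 0 send x = 1 to 0 and p = 1 keep x = 0, where the product is 1; in the
   open interval a survivor p has index p + 1. *)
pose S x := \sum_(p < D.+1) mask_prod a (k + j) (x + (p%:R - 1)).
have cS : continuous S.
  apply: continuous_big => [|p _ x]; first exact: (@add_continuous R).
  apply: (@continuous_comp _ _ _ (fun y => y + (p%:R - 1)) (mask_prod a (k + j))).
    by apply: cvgD; [exact: cvg_id | exact: cvg_cst].
  exact: continuous_mask_prod.
have [c c01 hc] := EVT_min (@ler01 R) (continuous_subspaceT cS).
have Spos x : 0 <= x <= 1 -> 0 < S x.
  move=> /andP[x0 x1].
  suff [p pP] : exists p : 'I_D.+1, mask_prod a (k + j) (x + (p%:R - 1)) != 0.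
    rewrite /S (bigD1 p)//= ltr_wpDr ?sumr_ge0// => [i _|].
      exact: mask_prod_ge0.
    by rewrite lt_neqAle eq_sym pP mask_prod_ge0.
  move: x0; rewrite le_eqVlt => /predU1P[<-|x0].
    have h : (1 < D.+1)%N by [].
    exists (Ordinal h); rewrite /= subrr addr0 mask_prod_at0.
    exact: oner_neq0.
  move: x1; rewrite le_eqVlt => /predU1P[->|x1].
    exists ord0; rewrite /= sub0r subrr mask_prod_at0; exact: oner_neq0.
  have [|p [pD hp]] := @mask_prod_survivor a k j x _ djk; first by apply/andP.
  have h : (p.+1 < D.+1)%N by [].
  by exists (Ordinal h); rewrite /= -natr1 addrK.
have Sc0 : 0 < S c by apply: Spos; rewrite in_itv in c01.
exists (S c / D.+1%:R) => [|x x01]; first by rewrite divr_gt0.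
suff [p pP] : exists p : 'I_D.+1,
    S c / D.+1%:R <= mask_prod a (k + j) (x + (p%:R - 1)).
  exists (p%:Z - 1); rewrite intrB; split => //.
  move/andP: x01 => [x0 x1]; rewrite ler_norml.
  have := ltn_ord p; rewrite ltnS -(ler_nat R) => pD.
  have D1 : 1 <= D%:R :> R by rewrite ler1n.
  have p0 : 0 <= p%:R :> R by [].
  by rewrite -pmulrn; apply/andP; split; lra.
apply: contrapT => /forallNP nex.
have : S x < S c.
  have -> : S c = \sum_(p < D.+1) S c / D.+1%:R.
    rewrite sumr_const card_ord -[RHS]mulr_natr divfK// pnatr_eq0//.
  rewrite /S; apply: ltr_sum => [|p _].
    by apply/hasP; exists ord0; rewrite ?mem_index_enum.
  by rewrite ltNge; exact/negP/nex.
by rewrite ltNge hc ?in_itv.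
Qed.

Lemma mask_prod_equipositive :
  exists2 e : R, 0 < e & forall a x, exists p : int, forall k,
    e <= mask_prod a k (x + p%:~R).
Proof.
(* This j gives C |z| <= 1/2 as soon as |z| <= 2^-j. *)
have [j hj] : exists j : nat, C * 2 <= 2 ^+ j.
  exists (Num.truncn (C * 2)).+1; rewrite ltW// (lt_le_trans (truncnS_gt _))//.
  by rewrite -natrX ler_nat ltnW// ltn_expl.
(* This k is large enough because n < 2^n. *)
pose k := (d * j)%N; have djk : (d * j < 2 ^ k)%N by rewrite ltn_expl.
(* The extra position makes the index type nonempty for [inord]; only the first k + j letters enter
   the product of length k + j. *)
pose word (w : {ffun 'I_(k + j).+1 -> I}) : nat -> I := fun i => w (inord i).
have /choice[f hf] : forall w, exists e : R, 0 < e /\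
    forall x, 0 <= x <= 1 -> exists p : int,
    `|x + p%:~R| <= (denom (word w) k)%:R /\
    e <= mask_prod (word w) (k + j) (x + p%:~R).
  by move=> w; have [e e0 he] := mask_prod_bounded_below (word w) djk; exists e.
pose e := \big[Num.min/1]_w f w.
have e0 : 0 < e.
  rewrite /e; elim/big_ind: _ => // [x y x0 y0|w _]; first by rewrite lt_min x0.
  by have [] := hf w.
exists (e / 2) => [|a x]; first by rewrite divr_gt0.
pose w : {ffun 'I_(k + j).+1 -> I} := [ffun i : 'I_(k + j).+1 => a i].
have aw i : (i < k + j)%N -> a i = word w i.
  by move=> ij; rewrite /word ffunE inordK// ltnW.
have [_ /(_ (x - (Num.floor x)%:~R))[]] := hf w.
  by have /andP[h1] := floor_itv x; rewrite intrD => h2; apply/andP; split; lra.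
move=> p [pD fp]; exists (p - Num.floor x) => K.
have -> : x + (p - Num.floor x)%:~R = x - (Num.floor x)%:~R + p%:~R.
  by rewrite intrB; ring.
set y := _ + p%:~R in pD fp *.
have {}fp : e <= mask_prod a (k + j) y.
  rewrite (eq_mask_prod _ aw); apply: le_trans fp.
  exact: bigmin_le.
have [Kkj|kjK] := leqP K (k + j).
  apply: (le_trans (_ : _ <= e)); first by lra.
  by apply: le_trans fp _; rewrite -(subnKC Kkj) mask_prod_nonincr.
rewrite -(subnKC (ltnW kjK)) mask_prod_split.
apply: ler_pM => //; first by rewrite ltW.
set b := shift_seq _ _; set i := (K - _)%N; set z := y / _.
have zle : C * `|z| <= 2^-1.
  have Dkj : (denom a (k + j))%:R = (denom a k)%:R * (denom (shift_seq a k) j)%:R :> R.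
    by rewrite denom_split natrM.
  have De : (denom a k)%:R = (denom (word w) k)%:R :> R.
    rewrite /denom; congr (_%:R); apply: eq_bigr => l _; rewrite aw//.
    by rewrite (leq_trans (ltn_ord l))// leq_addr.
  have zj : `|z| <= 2 ^- j.
    rewrite /z normrM normfV Dkj (@ger0_norm _ (_ * _)) ?mulr_ge0// invfM mulrA.
    rewrite -[leRHS]mul1r ler_pM ?mulr_ge0//.
      by rewrite ler_pdivrMr ?denomR_gt0// mul1r De.
    rewrite lef_pV2 ?posrE ?exprn_gt0 ?denomR_gt0//.
    by rewrite -natrX ler_nat denom_ge.
  apply: le_trans (ler_wpM2l C_ge0 zj) _.
  rewrite ler_pdivrMr ?exprn_gt0// mulrC ler_pdivlMr//.
have := mask_prod_lip b i z 0; rewrite mask_prod_at0 subr0 => h.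
have := le_trans h zle; rewrite ler_norml => /andP[h1 _]; lra.
Qed.


(** * Growing a spectrum along a word *)

Variable L : I -> seq int.
Hypothesis L0 : forall i, 0 \in L i.
Hypothesis q_sum : forall i x, \sum_(l <- L i) q i (x + l%:~R / (N i)%:R) = 1.

Section Spectrum.
Variables (a : nat -> I) (pick : nat -> R -> int).

(** [pick k x] stands for an integer whose addition to x makes the tails after k letters bounded
    below. Leaving lam fixed on the branch l = 0 is what makes the sets nested. *)
Definition spectrum_step k (lam l : int) : int :=
  if l == 0 then lam else lam + (denom a k)%:Z * l +
    (denom a k.+1)%:Z *
      pick k.+1 ((lam%:~R + (denom a k)%:R * l%:~R) / (denom a k.+1)%:R).

Fixpoint spectrum k : seq int :=
  if k is k'.+1 then
    [seq spectrum_step k' lam l | lam <- spectrum k', l <- L (a k')]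
  else [:: 0].

Lemma spectrum_stepE k lam l : exists z : int, spectrum_step k lam l =
  lam + (denom a k)%:Z * l + (denom a k.+1)%:Z * z.
Proof.
rewrite /spectrum_step; case: eqP => [->|_]; last by eexists.
by exists 0; rewrite !mulr0 !addr0.
Qed.

(** Parseval identity of the k-th partial product. The sum over the last letter is an instance of
    [q_sum], since a multiple of [denom a k.+1] is invisible to the first k + 1 factors. *)
Lemma spectrum_sum k x :
  \sum_(l <- spectrum k) mask_prod a k (x + l%:~R) = 1.
Proof.
elim: k x => [|k IH] x; first by rewrite /= big_seq1 /mask_prod big_ord0.
rewrite big_allpairs_dep -[RHS](IH x); apply: eq_bigr => lam _.
rewrite -[RHS]mulr1 -[X in _ = _ * X](q_sum (a k) ((x + lam%:~R) / (denom a k.+1)%:R)).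
rewrite mulr_sumr; apply: eq_bigr => l _.
have [z ->] := spectrum_stepE k lam l.
have D0 : (denom a k)%:R != 0 :> R by rewrite gt_eqF// denomR_gt0.
have N0 : (N (a k))%:R != 0 :> R by rewrite pnatr_eq0 -lt0n ltnW ?N_ge2.
rewrite mask_prodS denomS; congr (_ * _).
  rewrite -[in RHS](mask_prod_periodic a k _ (l + (N (a k))%:Z * z)); congr mask_prod.
  rewrite PoszM !(intrD, intrM) -!pmulrn. ring.
rewrite -[in RHS](q_periodic (a k) _ z); congr q.
by rewrite PoszM !(intrD, intrM) -!pmulrn natrM; field; exact/andP.
Qed.

Lemma spectrum_nested k : {subset spectrum k <= spectrum k.+1}.
Proof.
move=> lam lamk; apply/allpairsPdep; exists lam, 0; split => //.
Qed.

Lemma spectrum_subset k j : (k <= j)%N -> {subset spectrum k <= spectrum j}.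
Proof.
move=> kj lam; rewrite -(subnKC kj); elim: (j - k)%N => [|i IH]; first by rewrite addn0.
by move=> /IH; rewrite addnS; exact: spectrum_nested.
Qed.

(* Evaluate the sum at x = - l: the term of l is already 1. *)
Lemma spectrum_orthogonal k l l' : l \in spectrum k -> l' \in spectrum k ->
  l != l' -> mask_prod a k (l'%:~R - l%:~R) = 0.
Proof.
move=> lk l'k ll'; have := spectrum_sum k (- l%:~R).
rewrite (perm_big _ (perm_to_rem lk)) big_cons addNr mask_prod_at0.
have l'r : l' \in rem l (spectrum k).
  by move: l'k; rewrite (perm_mem (perm_to_rem lk)) inE eq_sym (negbTE ll').
rewrite (perm_big _ (perm_to_rem l'r)) big_cons/=.
have := mask_prod_ge0 a k (- l%:~R + l'%:~R).
have : 0 <= \sum_(j <- rem l' (rem l (spectrum k))) mask_prod a k (- l%:~R + j%:~R).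
  by apply: sumr_ge0 => j _; exact: mask_prod_ge0.
rewrite [l'%:~R - _]addrC => h1 h2 h3; lra.
Qed.

(** A repeated l would contribute the value 1 twice to the sum at x = - l. *)
Lemma spectrum_uniq k : uniq (spectrum k).
Proof.
have : forall l, l \in spectrum k -> l \notin rem l (spectrum k).
  move=> l lk; apply/negP => lr; have := spectrum_sum k (- l%:~R).
  rewrite (perm_big _ (perm_to_rem lk)) big_cons (perm_big _ (perm_to_rem lr)).
  rewrite big_cons addNr mask_prod_at0/=.
  have : 0 <= \sum_(j <- rem l (rem l (spectrum k))) mask_prod a k (- l%:~R + j%:~R).
    by apply: sumr_ge0 => j _; exact: mask_prod_ge0.
  lra.
elim: (spectrum k) => //= y s IH h; have ys : y \notin s.
  by have := h y; rewrite mem_head eqxx; apply.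
rewrite ys IH// => l ls; have := h l; rewrite inE ls orbT => /(_ isT).
by case: eqP => [yl|_]; [rewrite yl ls in ys | rewrite inE negb_or => /andP[]].
Qed.

Variable e : R.
Hypothesis e_gt0 : 0 < e.
Hypothesis pickP : forall k x j,
  e <= mask_prod (shift_seq a k) j (x + (pick k x)%:~R).

(** A kept frequency inherits the bound from one letter more, its next tail being a factor of the
    present one; a new frequency has it by the choice of [pick]. *)
Lemma spectrum_tail k l j : l \in spectrum k ->
  e <= mask_prod (shift_seq a k) j (l%:~R / (denom a k)%:R).
Proof.
elim: k l j => [|k IH] l j.
  rewrite inE => /eqP ->; rewrite mul0r mask_prod_at0.
  (* At 0 the product is 1, and e <= 1 because e bounds some mask product from below. *)
  exact: le_trans (pickP 0 0 0) (mask_prod_le1 _ _ _).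
move=> /allpairsPdep[lam [l' [lamk l'L ->]]]; rewrite /spectrum_step.
have D0 i : (denom a i)%:R != 0 :> R by rewrite gt_eqF// denomR_gt0.
case: eqP => [_|_].
  apply: le_trans (IH lam j.+1 lamk) _.
  rewrite -addn1 addnC mask_prod_split.
  have -> : denom (shift_seq a k) 1 = N (a k).
    by rewrite /denom big_ord1 /shift_seq addn0.
  have -> : shift_seq (shift_seq a k) 1 = shift_seq a k.+1.
    by apply/funext => i; rewrite /shift_seq addnA addn1.
  rewrite denomS natrM invfM mulrA ler_piMl ?mask_prod_ge0 ?mask_prod_le1//.
set p := pick _ _.
rewrite (_ : _ / _ =
    (lam%:~R + (denom a k)%:R * l'%:~R) / (denom a k.+1)%:R + p%:~R).
  exact: pickP.
by rewrite !(intrD, intrM) -!pmulrn; field.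
Qed.

Variable F : R -> R.
Hypothesis F_lim : forall x, mask_prod a k x @[k --> \oo] --> F x.

Lemma lim_mask_ge0 x : 0 <= F x.
Proof.
by apply: (cvgr_to_ge (@F_lim x)); near=> k; exact: mask_prod_ge0.
Unshelve. all: by end_near. Qed.

Lemma lim_mask_le k x : F x <= mask_prod a k x.
Proof.
apply: (cvgr_to_le (@F_lim x)); near=> j.
have kj : (k <= j)%N by near: j; exact: nbhs_infty_ge.
by rewrite -(subnKC kj) mask_prod_nonincr.
Unshelve. all: by end_near. Qed.

Lemma spectrum_lim_orthogonal k l l' : l \in spectrum k -> l' \in spectrum k ->
  l != l' -> F (l'%:~R - l%:~R) = 0.
Proof.
move=> lk l'k ll'; apply/eqP; rewrite eq_le lim_mask_ge0 andbT.
by rewrite -(spectrum_orthogonal lk l'k ll') lim_mask_le.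
Qed.

(** F (x + l) is the k-th product times the limit of the tail at (x + l) / [denom a k]. That point
    is within |x| / 2^k of l / [denom a k], where the tail is at least e, so for large k the
    Lipschitz bound leaves e / 2. *)
Lemma spectrum_lim_ge x : exists k0, forall k l, (k0 <= k)%N ->
  l \in spectrum k -> mask_prod a k (x + l%:~R) * (e / 2) <= F (x + l%:~R).
Proof.
have [k0 hk0] : exists k0 : nat, C * `|x| <= e / 2 * 2 ^+ k0.
  exists (Num.truncn (C * `|x| / (e / 2))).+1.
  rewrite [leRHS]mulrC -ler_pdivrMr ?divr_gt0// ltW// (lt_le_trans (truncnS_gt _))//.
  by rewrite -natrX ler_nat ltnW// ltn_expl.
exists k0 => k l k0k lk; apply: (cvgr_to_ge (@F_lim _)); near=> j.
have kj : (k <= j)%N by near: j; exact: nbhs_infty_ge.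
rewrite -(subnKC kj) mask_prod_split ler_wpM2l ?mask_prod_ge0//.
set b := shift_seq _ _; set i := (j - k)%N; set D := (denom a k)%:R.
have h1 := spectrum_tail i lk.
have := mask_prod_lip b i ((x + l%:~R) / D) (l%:~R / D).
rewrite mulrDl addrK normrM normfV.
have D0 : 0 < D by exact: denomR_gt0.
have h2 : C * (`|x| / `|D|) <= e / 2.
  rewrite (gtr0_norm D0) mulrA ler_pdivrMr//; apply: le_trans hk0 _.
  rewrite ler_wpM2l ?divr_ge0 ?(ltW e_gt0)//.
  by rewrite -natrX ler_nat (leq_trans _ (denom_ge a k))// leq_exp2l.
move=> /le_trans/(_ h2); rewrite -mulrDl ler_norml => /andP[h3 _].
move: h1; rewrite -/b -/i -/D => h1; lra.
Unshelve. all: by end_near. Qed.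

Lemma spectrum_lim_sum_le1 k x : \sum_(l <- spectrum k) F (x + l%:~R) <= 1.
Proof.
rewrite -[leRHS](spectrum_sum k x); apply: ler_sum => l _; exact: lim_mask_le.
Qed.

Lemma spectrum_big_split (G : int -> R) k j : (k <= j)%N ->
  \sum_(l <- spectrum j) G l = \sum_(l <- spectrum k) G l +
    \sum_(l <- spectrum j | l \notin spectrum k) G l.
Proof.
move=> kj; rewrite (bigID (mem (spectrum k)))/=; congr (_ + _).
rewrite -big_filter; apply: perm_big; apply: uniq_perm.
- by rewrite filter_uniq ?spectrum_uniq.
- exact: spectrum_uniq.
- by move=> l; rewrite mem_filter andb_idr//; exact: spectrum_subset.
Qed.

(* Dominated convergence along the nested sets spectrum k, by hand:
   spectrum_lim_ge dominates the terms of spectrum_sum by those of F. *)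
Lemma spectrum_complete x (eps : R) : 0 < eps ->
  exists k, 1 - eps <= \sum_(l <- spectrum k) F (x + l%:~R).
Proof.
move=> eps0; pose s k := \sum_(l <- spectrum k) F (x + l%:~R).
have [k0 hk0] := spectrum_lim_ge x.
have e2 : 0 < e / 2 by rewrite divr_gt0.
have s_mono k j : (k <= j)%N -> s k <= s j.
  move=> kj; rewrite /s (spectrum_big_split _ kj) lerDl.
  by apply: sumr_ge0 => l _; exact: lim_mask_ge0.
have hs : has_sup (range s).
  split; first by exists (s 0%N), 0%N.
  by exists 1 => _ [k _ <-]; exact: spectrum_lim_sum_le1.
(* The gap to the supremum is eps e / 2, since the factor e / 2 of the domination is divided out:
   outside [spectrum k1] the mask products add up to at most eps. *)
have d0 : 0 < eps * (e / 2) by rewrite mulr_gt0.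
have [_ [k2 _ <-] hk2] := sup_adherent d0 hs.
pose k1 := maxn k0 k2; exists k1.
have hk1 k : s k - s k1 <= eps * (e / 2).
  have : s k <= sup (range s) by apply: ub_le_sup; [exact: hs.2 | exists k].
  have : s k2 <= s k1 by rewrite s_mono// leq_maxr.
  lra.
have lim1 : \sum_(l <- spectrum k1) mask_prod a k (x + l%:~R) @[k --> \oo] --> s k1.
  apply: cvg_big => [|l _]; first exact: (@add_continuous R).
  exact: F_lim.
apply: (cvgr_to_ge lim1); near=> k.
have kk1 : (k1 <= k)%N by near: k; exact: nbhs_infty_ge.
have := spectrum_sum k x; rewrite (spectrum_big_split _ kk1).
have : (\sum_(l <- spectrum k | l \notin spectrum k1) mask_prod a k (x + l%:~R))
    * (e / 2) <= eps * (e / 2).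
  apply: le_trans (hk1 k); rewrite /s (spectrum_big_split _ kk1) addrAC subrr add0r.
  rewrite mulr_suml big_seq_cond [leRHS]big_seq_cond.
  apply: ler_sum => l /andP[lk _]; apply: hk0 => //.
  by apply: leq_trans kk1; exact: leq_maxl.
rewrite ler_pM2r// => h1 h2; lra.
Unshelve. all: by end_near. Qed.

End Spectrum.

(** The last two clauses are the Jorgensen-Pedersen criterion for the union of the [Lam k]: F
    vanishes at differences, and the sums of F (x + l) get above 1 - eps. *)
Theorem mask_spectrum a (F : R -> R) :
  (forall x, mask_prod a k x @[k --> \oo] --> F x) ->
  exists Lam : nat -> seq int,
  [/\ forall k, uniq (Lam k),
      forall k j, (k <= j)%N -> {subset Lam k <= Lam j},
      forall k l l', l \in Lam k -> l' \in Lam k -> l != l' ->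
        F (l'%:~R - l%:~R) = 0
    & forall x eps, 0 < eps ->
        exists k, 1 - eps <= \sum_(l <- Lam k) F (x + l%:~R)].
Proof.
move=> F_lim; have [e e0 he] := mask_prod_equipositive.
have /choice[pick0 hpick0] : forall kx : nat * R, exists p : int, forall j,
    e <= mask_prod (shift_seq a kx.1) j (kx.2 + p%:~R).
  by move=> [k x]; exact: he.
pose pick k x := pick0 (k, x); exists (spectrum a pick); split.
- exact: spectrum_uniq.
- exact: spectrum_subset.
- by move=> k l l'; exact: spectrum_lim_orthogonal.
- by move=> x eps; apply: (spectrum_complete e0) => // k y j; exact: (hpick0 (k, y)).
Qed.

End Words.

(** * The mask of a digit set *)

Section Trigonometry.
Variable R : realType.
Implicit Types (x y t : R) (z : int).

Lemma cosD_2piM x z : cos (x + 2 * pi * z%:~R) = cos x.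
Proof.
have p2 : 2 * pi = pi *+ 2 :> R by rewrite mulr_natl.
case: z => n; first by rewrite p2 -pmulrn mulr_natr (periodicn (@cosD2pi R)).
rewrite NegzE -[in RHS](subrK (2 * pi * n.+1%:R) x) p2 mulr_natr.
by rewrite (periodicn (@cosD2pi R)) intrN mulrN -pmulrn mulr_natr.
Qed.

Lemma sinD_2piM x z : sin (x + 2 * pi * z%:~R) = sin x.
Proof. by rewrite -!cosBpihalf addrAC cosD_2piM. Qed.

(** The fractional part u satisfies cos (2 pi u) = 1 - 2 sin (pi u)^2, and sin (pi u) > 0 if 0 < u <
    1. *)
Lemma cos_2pi_eq1 t : cos (2 * pi * t) = 1 -> is_integer t.
Proof.
move=> ct; exists (Num.floor t).
have /andP[fl] := floor_itv t; rewrite intrD => fu.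
set u := t - (Num.floor t)%:~R.
have cu : cos (2 * pi * u) = 1.
  rewrite -[RHS]ct -(cosD_2piM (2 * pi * u) (Num.floor t)); congr cos.
  by rewrite /u; ring.
suff : ~ 0 < u by rewrite /u => h; lra.
move=> u0; have pi0 := pi_gt0 R.
have : 0 < sin (pi * u).
  apply: sin_gt0_pi; rewrite mulr_gt0//= gtr_pMr// /u; lra.
move: cu; rewrite (_ : 2 * pi * u = (pi * u) *+ 2); last by rewrite -mulr_natl; ring.
rewrite cos_mulr2n cos2sin2 -mulr_natl => h h0.
have : sin (pi * u) ^+ 2 = 0 by lra.
by move/eqP; rewrite sqrf_eq0 gt_eqF.
Qed.

Lemma cos_lipschitz x y : `|cos x - cos y| <= `|x - y|.
Proof.
wlog xy : x y / (x <= y).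
  move=> h; have [/h//|/ltW/h] := leP x y.
  by rewrite distrC [leRHS]distrC.
rewrite distrC [leRHS]distrC.
have [c _ ->] := MVT_segment (f := cos) (df := fun x => - sin x) xy
  (fun u _ => is_derive_cos u) (continuous_subspaceT (@continuous_cos R)).
by rewrite normrM normrN ler_piMl// sin_max.
Qed.

Lemma expiD x y : expi (x + y) = expi x * expi y.
Proof. by rewrite /expi cosD sinD; simpc; congr (_ +i* _); ring. Qed.

Lemma expi0 : expi (0 : R) = 1.
Proof. by rewrite /expi cos0 sin0. Qed.

Lemma expiMn x n : expi (x * n%:R) = expi x ^+ n.
Proof.
elim: n => [|n IH]; first by rewrite mulr0 expi0.
by rewrite -natr1 mulrDr mulr1 expiD IH exprSr.
Qed.

Lemma conjc_expi x : (expi x)^* = expi (- x).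
Proof. by rewrite /expi cosN sinN. Qed.

Lemma expi_inj s t : 0 <= s < 1 -> 0 <= t < 1 ->
  expi (2 * pi * s) = expi (2 * pi * t) -> s = t.
Proof.
move=> /andP[s0 s1] /andP[t0 t1] st.
have : cos (2 * pi * (s - t)) = 1.
  rewrite mulrBr cosB; case: st => -> ->.
  by rewrite -!expr2 cos2Dsin2.
move=> /cos_2pi_eq1[z zE].
have : `|z%:~R| < 1 :> R by rewrite -zE ltr_norml; lra.
rewrite -intr_norm -[1]/(1%:~R) ltr_int => z1.
have z0 : z = 0 by lia.
by apply/eqP; rewrite -subr_eq0 zE z0.
Qed.

End Trigonometry.

Section Mask.
Variables (R : realType) (B : seq int).

(** The squared modulus q_B of the normalised exponential sum, in real and imaginary parts so that
    it takes values in R. *)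
Definition mask (t : R) : R :=
  ((\sum_(b <- B) cos (2 * pi * b%:~R * t)) ^+ 2 +
   (\sum_(b <- B) sin (2 * pi * b%:~R * t)) ^+ 2) / (size B)%:R ^+ 2.

Lemma mask_double_sum t : mask t =
  (\sum_(b <- B) \sum_(b' <- B) cos (2 * pi * (b - b')%:~R * t)) / (size B)%:R ^+ 2.
Proof.
rewrite /mask; congr (_ / _); rewrite !expr2 !mulr_suml -big_split/=.
apply: eq_bigr => b _; rewrite !mulr_sumr -big_split/=; apply: eq_bigr => b' _.
by rewrite -cosB intrB; congr cos; ring.
Qed.

Lemma mask_ge0 t : 0 <= mask t.
Proof. by rewrite divr_ge0 ?addr_ge0 ?sqr_ge0. Qed.

Lemma mask_periodic t (z : int) : mask (t + z%:~R) = mask t.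
Proof.
rewrite /mask; congr ((_ ^+ 2 + _ ^+ 2) / _); apply: eq_bigr => b _.
  by rewrite mulrDr -[_ * _ * _ * z%:~R]mulrA -intrM cosD_2piM.
by rewrite mulrDr -[_ * _ * _ * z%:~R]mulrA -intrM sinD_2piM.
Qed.

Lemma maskN t : mask (- t) = mask t.
Proof.
rewrite !mask_double_sum; congr (_ / _); apply: eq_bigr => b _.
by apply: eq_bigr => b' _; rewrite mulrN cosN.
Qed.

Hypothesis B_gt0 : (0 < size B)%N.

Let sB0 : 0 < (size B)%:R :> R. Proof. by rewrite ltr0n. Qed.

Let sum1B : \sum_(b <- B) \sum_(b' <- B) (1 : R) = (size B)%:R ^+ 2.
Proof.
have E (G : R) : \sum_(b <- B) G = G * (size B)%:R.
  by rewrite big_const_seq count_predT iter_addr_0 mulr_natr.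
by rewrite !E mul1r expr2.
Qed.

Lemma mask_le1 t : mask t <= 1.
Proof.
rewrite mask_double_sum ler_pdivrMr ?exprn_gt0// mul1r -sum1B.
by apply: ler_sum => b _; apply: ler_sum => b' _; exact: cos_le1.
Qed.

Lemma mask0 : mask 0 = 1.
Proof.
rewrite mask_double_sum; under eq_bigr do under eq_bigr do rewrite mulr0 cos0.
by rewrite sum1B divff// gt_eqF// exprn_gt0.
Qed.

(** A mean of cosines equals 1 only if each of them does. *)
Lemma mask_eq1 t : mask t = 1 ->
  forall b b', b \in B -> b' \in B -> is_integer ((b - b')%:~R * t).
Proof.
move=> t1.
have : \sum_(b <- B) \sum_(b' <- B) (1 - cos (2 * pi * (b - b')%:~R * t)) = 0.
  under eq_bigr do rewrite sumrB; rewrite sumrB sum1B.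
  by move: t1; rewrite mask_double_sum => /divr1_eq ->; rewrite subrr.
have ge0 c : 0 <= 1 - cos (2 * pi * c * t) by rewrite subr_ge0 cos_le1.
move=> /eqP; rewrite psumr_eq0; last by move=> b _; apply: sumr_ge0.
move=> /allP h b b' bB b'B; have := h b bB.
rewrite /= psumr_eq0// => /allP/(_ b' b'B)/=; rewrite subr_eq0 => /eqP.
by rewrite -mulrA => /esym/cos_2pi_eq1.
Qed.

Lemma mask_lipschitz : exists2 C : R, 0 <= C &
  forall s t, `|mask s - mask t| <= C * `|s - t|.
Proof.
exists (\sum_(b <- B) \sum_(b' <- B) `|2 * pi * (b - b')%:~R|).
  by apply: sumr_ge0 => b _; apply: sumr_ge0.
move=> s t; rewrite !mask_double_sum -mulrBl normrM -sumrB.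
apply: (@le_trans _ _ `|\sum_(b <- B) (\sum_(b' <- B) cos (2 * pi * (b - b')%:~R * s) -
   \sum_(b' <- B) cos (2 * pi * (b - b')%:~R * t))|).
  rewrite ler_piMr// ger0_norm ?invr_ge0 ?exprn_ge0// invf_le1 ?exprn_gt0//.
  by rewrite -natrX ler1n expn_gt0 B_gt0.
apply: le_trans (ler_norm_sum _ _ _) _; rewrite mulr_suml.
apply: ler_sum => b _; rewrite -sumrB; apply: le_trans (ler_norm_sum _ _ _) _.
rewrite mulr_suml; apply: ler_sum => b' _.
by apply: le_trans (cos_lipschitz _ _) _; rewrite -mulrBr normrM.
Qed.

(** With z = e^{2 pi i t} and exponents shifted by M to be nonnegative, the exponential sum is a
    polynomial in z up to a power of z, nonzero because its value at 1 is the size of B; distinct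
    zeros in [0, 1[ give distinct roots. *)
Lemma mask_zeros : exists d : nat, forall s : seq R, uniq s ->
  (forall t, t \in s -> 0 <= t < 1 /\ mask t = 0) -> (size s <= d)%N.
Proof.
have [M hM] : exists M : nat, forall b, b \in B -> 0 <= b + M%:Z.
  elim: B => [|b s [M hM]]; first by exists 0%N.
  exists (M + `|b|)%N => c; rewrite inE => /orP[/eqP ->|/hM]; lia.
pose p : {poly R[i]} := \sum_(b <- B) 'X^`|b + M%:Z|.
have p0 : p != 0.
  apply/eqP => /(congr1 (fun r => r.[1])); rewrite horner0 /p horner_sum.
  under eq_bigr do rewrite hornerXn expr1n.
  rewrite big_const_seq count_predT iter_addr_0 => /eqP.
  by rewrite pnatr_eq0 -leqn0 leqNgt B_gt0.
exists (size p) => s us hs.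
rewrite -(size_map (fun t => expi (2 * pi * t))) ltnW//; apply: max_poly_roots => //.
- apply/allP => _ /mapP[t /hs[_ mt] ->]; rewrite rootE /p horner_sum.
  have [c0 s0] : \sum_(b <- B) cos (2 * pi * b%:~R * t) = 0 /\
                 \sum_(b <- B) sin (2 * pi * b%:~R * t) = 0.
    move/eqP: mt; rewrite /mask mulf_eq0 invr_eq0 [X in _ || X]gt_eqF ?exprn_gt0// orbF.
    by rewrite paddr_eq0 ?sqr_ge0// !sqrf_eq0 => /andP[/eqP -> /eqP ->].
  rewrite big_seq; under eq_bigr => b bB.
    rewrite hornerXn -expiMn.
    have -> : 2 * pi * t * `|b + M%:Z|%:R = 2 * pi * b%:~R * t + 2 * pi * t * M%:R.
      have -> : `|b + M%:Z|%:R = (b + M%:Z)%:~R :> R by rewrite pmulrn gez0_abs ?hM.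
      by rewrite intrD -pmulrn; ring.
    rewrite expiD; over.
  rewrite -big_seq -mulr_suml; apply/eqP.
  rewrite (_ : \sum_(b <- B) _ = 0) ?mul0r//.
  apply/eqP; rewrite eq_complex/=.
  by rewrite !raddf_sum/= c0 s0 !eqxx.
- rewrite map_inj_in_uniq// => t t' /hs[tI _] /hs[t'I _]; exact: expi_inj.
Qed.

End Mask.

(** * Masks of Hadamard triples *)

Section Hadamard.
Variables (R : realType) (N : int) (B L : {fset int}).
Hypothesis hadamard : hadamard_triple R N B L.

(** Orthonormality of the rows of the unitary matrix, multiplied by #B and split into real and
    imaginary parts. *)
Lemma hadamard_cos_sum b b' : b \in B -> b' \in B ->
  \sum_(l <- L) cos (2 * pi * (b - b')%:~R * (l%:~R / N%:~R)) =
    #|` B|%:R * (b == b')%:R :> R /\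
  \sum_(l <- L) sin (2 * pi * (b - b')%:~R * (l%:~R / N%:~R)) = 0 :> R.
Proof.
move=> bB b'B; have [_ _ B2 /unitarymxP UU] := hadamard.
have hi : (index b B < #|` B|)%N by rewrite index_mem.
have hi' : (index b' B < #|` B|)%N by rewrite index_mem.
(* Entry (b', b) is taken because conjugation reverses the sign in row b, which leaves the frequency
   b - b'. *)
move: UU => /matrixP/(_ (Ordinal hi') (Ordinal hi)).
rewrite !mxE -val_eqE/=.
under eq_bigr => j _.
  rewrite !mxE/= !nth_index// rmorphM/=.
  rewrite -[X in _ * (X * _)]/(conjc _) -[X in _ * (_ * X)]/(conjc _) conjc_expi.
  rewrite conjc_real mulrACA -rmorphM -expiD -invfM -expr2 sqr_sqrtr//.
  rewrite opprK (_ : _ + _ = 2 * pi * (b - b')%:~R * ((L`_j)%:~R / N%:~R)); last first.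
    by rewrite intrB; ring.
  over.
rewrite -mulr_sumr.
have n0 : #|` B|%:R != 0 :> R by rewrite pnatr_eq0 -lt0n ltnW.
rewrite (_ : (index b' B == index b B) = (b == b')); last first.
  by apply/eqP/eqP => [e|->//]; rewrite -(nth_index 0 bB) -(nth_index 0 b'B) e.
move=> /(congr1 (fun z => (#|` B|%:R : R)%:C * z)).
rewrite mulrA -rmorphM divff// mul1r.
rewrite [X in _ -> X = _ /\ _](big_nth 0) [X in _ -> _ /\ X = _](big_nth 0).
rewrite !big_mkord => e.
have [re im] : complex.Re (\sum_(j < #|` L|)
      expi (2 * pi * (b - b')%:~R * ((L`_j)%:~R / N%:~R))) = #|` B|%:R * (b == b')%:R :> R /\
   complex.Im (\sum_(j < #|` L|)
      expi (2 * pi * (b - b')%:~R * ((L`_j)%:~R / N%:~R))) = 0 :> R.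
  by rewrite e; case: (b == b'); simpc.
by split; [rewrite -re raddf_sum | rewrite -[RHS]im raddf_sum].
Qed.

(** In the double sum of the mask, summation over L kills the terms b != b' and leaves #B for each
    b, hence #B^2 in all. *)
Lemma hadamard_mask_sum (t : R) :
  \sum_(l <- L) mask B (t + l%:~R / N%:~R) = 1.
Proof.
have [_ _ B2 _] := hadamard.
have n0 : #|` B|%:R != 0 :> R by rewrite pnatr_eq0 -lt0n ltnW.
under eq_bigr do rewrite mask_double_sum.
rewrite -mulr_suml exchange_big/=.
under eq_bigr do rewrite exchange_big/=.
rewrite (_ : \sum_(b <- B) _ = #|` B|%:R ^+ 2); first by rewrite divff// expf_neq0.
transitivity (\sum_(b <- B) (#|` B|%:R : R)); last first.
  by rewrite big_const_seq count_predT iter_addr_0 -[LHS]mulr_natr expr2.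
rewrite big_seq [RHS]big_seq; apply: eq_bigr => b bB.
transitivity (\sum_(b' <- B) cos (2 * pi * (b - b')%:~R * t) *
    (#|` B|%:R * (b == b')%:R) : R).
  rewrite big_seq [RHS]big_seq; apply: eq_bigr => b' b'B.
  have [hc hs] := hadamard_cos_sum bB b'B.
  under eq_bigr do rewrite mulrDr cosD.
  by rewrite sumrB -!mulr_sumr hc hs mulr0 subr0.
rewrite (bigD1_seq b)//= ?fset_uniq// eqxx subrr mulr0 mul0r cos0 mul1r mulr1.
rewrite big1 ?addr0// => b' /negbTE b'b; by rewrite eq_sym b'b !mulr0.
Qed.

(** L is translated to contain 0, and the sign of N is absorbed so that the scale becomes the
    natural number |N|; the sum over L is 1 at every t, so it survives both changes. *)
Definition digit_spec : seq int := [seq sgz N * (l - head 0 L) | l <- L].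

Lemma digit_spec0 : 0 \in digit_spec.
Proof.
have [_ BL B2 _] := hadamard.
apply/mapP; exists (head 0 L); last by rewrite subrr mulr0.
have : (0 < size L)%N by rewrite -BL ltnW.
by case: (enum_fset L) => //= l s _; rewrite mem_head.
Qed.

Lemma digit_spec_sum (t : R) :
  \sum_(l <- digit_spec) mask B (t + l%:~R / `|N|%N%:R) = 1.
Proof.
rewrite big_map -[RHS](hadamard_mask_sum (t - (head 0 L)%:~R / N%:~R)).
have [N2 _ _ _] := hadamard.
have NE : N%:~R = (sgz N)%:~R * `|N|%N%:R :> R.
  by rewrite [in LHS](intEsg N) intrM -pmulrn.
have s2 : (sgz N)%:~R * (sgz N)%:~R = 1 :> R.
  rewrite -intrM /sgz; case: eqP N2 => [->//|_ _].
  by case: ifP; rewrite ?mulrNN mulr1.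
have N0 : `|N|%N%:R != 0 :> R by rewrite pnatr_eq0; lia.
apply: eq_bigr => l _; congr mask; rewrite NE intrM intrB.
have s0 : (sgz N)%:~R != 0 :> R.
  by apply/eqP => s0; move/esym/eqP: s2; rewrite s0 mul0r oner_eq0.
have sV : (sgz N)%:~R = (sgz N)%:~R^-1 :> R.
  by apply: (mulfI s0); rewrite s2 divff.
by rewrite [in LHS]sV; field; exact/andP.
Qed.

Hypothesis gcd1 : gcd_fset (diff_fset B) = 1.

(** The integers c with c t an integer contain all differences of digits and, by Bezout, are closed
    under gcd. *)
Lemma mask_eq1_integer (t : R) : mask B t = 1 -> is_integer t.
Proof.
move=> /mask_eq1 h.
suff : is_integer ((gcd_fset (diff_fset B))%:~R * t) by rewrite gcd1 mul1r.
rewrite /gcd_fset big_seq; elim/big_ind: _.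
- by exists 0; rewrite mul0r.
- move=> a b [u au] [v bv]; have [c [d <-]] := Bezoutz a b.
  by exists (c * u + d * v); rewrite !(intrD, intrM) mulrDl -!mulrA au bv.
- by move=> a /imfset2P[b /= bB [b' b'B ->]]; exact: h.
Qed.

End Hadamard.

(** A single nonzero term would equal 1 and put (x + l) / n, hence x, among the integers. So two
    terms are nonzero, and their indices may be reduced modulo n. *)
Lemma two_branches (R : realType) (n : nat) (q : R -> R) (L : seq int) :
  (2 <= n)%N -> (forall t, 0 <= q t) -> q 0 = 1 ->
  (forall t (z : int), q (t + z%:~R) = q t) ->
  (forall t, \sum_(l <- L) q (t + l%:~R / n%:R) = 1) ->
  (forall t, q t = 1 -> is_integer t) ->
  forall x, ~ is_integer x -> exists l l' : nat,
    [/\ (l < l')%N, (l' < n)%N, q ((x + l%:R) / n%:R) != 0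
      & q ((x + l'%:R) / n%:R) != 0].
Proof.
move=> n2 q_ge0 q0 q_per q_sum q1 x xNZ.
have n0 : n%:R != 0 :> R by rewrite pnatr_eq0 -lt0n ltnW.
have sumE t : \sum_(l <- L) q ((t + l%:~R) / n%:R) = 1.
  by under eq_bigr do rewrite mulrDl; exact: q_sum.
have exq s : \sum_(l <- s) q ((x + l%:~R) / n%:R) != 0 ->
    exists2 l, l \in s & q ((x + l%:~R) / n%:R) != 0.
  by rewrite psumr_neq0// => /hasP[l ls /= ql]; exists l => //; rewrite gt_eqF.
have [l lL ql] : exists2 l, l \in L & q ((x + l%:~R) / n%:R) != 0.
  by apply: exq; rewrite sumE oner_eq0.
have [l' l'L ql'] : exists2 l', l' \in rem l L & q ((x + l'%:~R) / n%:R) != 0.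
  apply: exq; apply/eqP => s0; have := sumE x.
  rewrite (perm_big _ (perm_to_rem lL)) big_cons/= s0 addr0 => /q1[z /eqP].
  rewrite eq_sym -(inj_eq (mulIf n0)) divfK// => /eqP zE; apply: xNZ.
  by exists (z * n%:Z - l); rewrite intrB intrM -pmulrn zE addrK.
pose r (i : int) : nat := `|(i %% n)%Z|%N.
have rE i : i = (i %/ n)%Z * n%:Z + (r i)%:Z.
  by rewrite {1}(divz_eq i n) /r gez0_abs// modz_ge0//; lia.
have rn i : (r i < n)%N.
  by rewrite /r -ltz_nat gez0_abs ?modz_ge0// ?ltz_pmod//; lia.
have qr i : q ((x + i%:~R) / n%:R) = q ((x + (r i)%:R) / n%:R).
  rewrite -[RHS](q_per _ (i %/ n)%Z); congr q.
  by rewrite {1}(rE i) intrD intrM -!pmulrn; field.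
(* Equal residues would give two terms equal to 1 in the sum at - l. *)
have rr' : r l != r l'.
  apply/eqP => rr'; have := sumE (- l%:~R).
  rewrite (perm_big _ (perm_to_rem lL)) big_cons/= (perm_big _ (perm_to_rem l'L)).
  rewrite big_cons/= addNr mul0r q0.
  have -> : (- l%:~R + l'%:~R) / n%:R = 0 + ((l' %/ n)%Z - (l %/ n)%Z)%:~R :> R.
    rewrite {1}(rE l) {1}(rE l') rr' !(intrD, intrM, intrN) -!pmulrn; field.
    done.
  rewrite q_per q0 => /eqP.
  rewrite -subr_eq0 addrAC subrr add0r paddr_eq0//; last exact: sumr_ge0.
  by rewrite oner_eq0.
move: ql ql'; rewrite !qr => ql ql'.
by have [h|h|/eqP] := ltngtP (r l) (r l'); last (by rewrite (negbTE rr'));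
  [exists (r l), (r l') | exists (r l'), (r l)].
Qed.

(** * Moran masks as words of letters *)

Section Moran.
Variables (R : realType) (m : nat) (N : 'I_m -> int) (B L : 'I_m -> {fset int}).
Variables (n : nat -> nat) (omega : nat -> 'I_m).
Hypothesis hadamard : forall j, hadamard_triple R (N j) (B j) (L j).
Hypothesis gcd1 : forall j, gcd_fset (diff_fset (B j)) = 1.
Hypothesis n_gt0 : forall k, (0 < n k)%N.

(* The letter (j, false) stands for the trivial triple (N_j, {0}, {0}): the
   block N_j ^ n_k B_j is spelled as n_k - 1 trivial letters and then
   (j, true), so that finitely many letters suffice although n is unbounded. *)
Definition letter_scale (c : 'I_m * bool) : nat := `|N c.1|%N.
Definition letter_digits (c : 'I_m * bool) : seq int :=
  if c.2 then enum_fset (B c.1) else [:: 0].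
Definition letter_spec (c : 'I_m * bool) : seq int :=
  if c.2 then digit_spec (N c.1) (L c.1) else [:: 0].

(* In the state (k, r), the remaining part of block k has r + 1 letters. *)
Fixpoint block_state (t : nat) : nat * nat :=
  if t is t'.+1 then
    let: (k, r) := block_state t' in
    if r is r'.+1 then (k, r') else (k.+1, (n k.+1).-1)
  else (0%N, (n 0).-1).

Definition letters (t : nat) : 'I_m * bool :=
  (omega (block_state t).1, (block_state t).2 == 0%N).

Definition block_denom k : nat := \prod_(i < k) `|N (omega i)|%N ^ n i.

(** The squared Fourier transform of the convolution of the first k factors, with the signs of the
    N_j kept. *)
Definition moran_mask k (x : R) : R := \prod_(i < k)
  mask (B (omega i)) (x * \prod_(j < i.+1) (N (omega j))%:~R ^- n j).

Lemma letter_scale_ge2 c : (2 <= letter_scale c)%N.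
Proof. by rewrite /letter_scale; have [h _ _ _] := hadamard c.1; lia. Qed.

Lemma size_letter_digits c : (0 < size (letter_digits c))%N.
Proof.
rewrite /letter_digits; case: c.2 => //; have [_ _ h _] := hadamard c.1.
exact: ltnW.
Qed.

Lemma mask_seq1 (x : R) : mask [:: 0] x = 1.
Proof.
by rewrite /mask !big_seq1 mulr0 mul0r cos0 sin0 !expr1n expr0n addr0 divr1.
Qed.

Lemma letter_spec_sum c (x : R) : \sum_(l <- letter_spec c)
  mask (letter_digits c) (x + l%:~R / (letter_scale c)%:R) = 1.
Proof.
rewrite /letter_spec /letter_digits /letter_scale; case: c => j [] /=.
  exact: (digit_spec_sum (hadamard j)).
by rewrite big_seq1 mask_seq1.
Qed.

Lemma letter_spec0 c : 0 \in letter_spec c.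
Proof.
rewrite /letter_spec; case: c => j [] /=; last by rewrite inE.
exact: (digit_spec0 (hadamard j)).
Qed.

Lemma letter_two_branches c (x : R) : ~ is_integer x -> exists l l' : nat,
  [/\ (l < l')%N, (l' < letter_scale c)%N,
      mask (letter_digits c) ((x + l%:R) / (letter_scale c)%:R) != 0
    & mask (letter_digits c) ((x + l'%:R) / (letter_scale c)%:R) != 0].
Proof.
have N2 := letter_scale_ge2 c; case: c N2 => j [] N2 xNZ.
  apply: (two_branches (L := letter_spec (j, true))) => //.
  - exact: mask_ge0.
  - exact/mask0/(size_letter_digits (j, true)).
  - exact: mask_periodic.
  - exact: (letter_spec_sum (j, true)).
  - exact: (mask_eq1_integer (gcd1 j)).
by exists 0%N, 1%N; rewrite !mask_seq1 oner_neq0; split.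
Qed.

Lemma letter_lipschitz : exists2 C : R, 0 <= C & forall c x y,
  `|mask (letter_digits c) x - mask (letter_digits c) y| <= C * `|x - y|.
Proof.
have /choice[C hC] : forall c, exists C : R, 0 <= C /\ forall x y,
    `|mask (letter_digits c) x - mask (letter_digits c) y| <= C * `|x - y|.
  by move=> c; have [C C0 hC] := mask_lipschitz R (size_letter_digits c); exists C.
exists (\sum_c C c) => [|c x y]; first by apply: sumr_ge0 => c _; case: (hC c).
have [_ /(_ x y)/le_trans] := hC c; apply; rewrite ler_wpM2r//.
by rewrite (bigD1 c)//= lerDl sumr_ge0// => i _; case: (hC i).
Qed.

Lemma letter_zeros : exists d : nat, forall c (s : seq R), uniq s ->
  (forall t, t \in s -> 0 <= t < 1 /\ mask (letter_digits c) t = 0) ->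
  (size s <= d)%N.
Proof.
have /choice[d hd] := fun c => mask_zeros R (size_letter_digits c).
exists (\sum_c d c)%N => c s us hs; apply: leq_trans (hd c s us hs) _.
by rewrite (bigD1 c)//= leq_addr.
Qed.

Lemma eq_norm_mask (D : seq int) (x y : R) : `|x| = `|y| -> mask D x = mask D y.
Proof.
by move=> /eqP; rewrite eqr_norm2 => /orP[] /eqP ->; rewrite ?maskN.
Qed.

Lemma block_stateP t :
  (denom letter_scale letters t * `|N (omega (block_state t).1)| ^ (block_state t).2.+1 =
    block_denom (block_state t).1.+1)%N /\
  forall x : R, mask_prod letter_scale (fun c => mask (letter_digits c)) letters t x =
    \prod_(i < (block_state t).1) mask (B (omega i)) (x / (block_denom i.+1)%:R).
Proof.
elim: t => [|t]; first split.
- by rewrite /denom /block_denom big_ord0 big_ord1/= mul1n prednK ?n_gt0.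
- by move=> x; rewrite /mask_prod !big_ord0.
have E : letters t = (omega (block_state t).1, (block_state t).2 == 0%N) by [].
move: E; rewrite denomS /=; case: (block_state t) => k [|r] /= E [IHd IHm].
  have IHd' : (denom letter_scale letters t * letter_scale (letters t) = block_denom k.+1)%N.
    by rewrite -IHd E expn1.
  split; first by rewrite IHd' prednK ?n_gt0// [RHS]/block_denom big_ord_recr.
  move=> x; rewrite mask_prodS IHm denomS IHd' big_ord_recr /=; congr (_ * _).
  by rewrite E.
split; first by rewrite -IHd E [in RHS]expnS mulnA.
by move=> x; rewrite mask_prodS IHm E /letter_digits/= mask_seq1 mulr1.
Qed.

Lemma mask_prod_letters t x :
  mask_prod letter_scale (fun c => mask (letter_digits c)) letters t x =
  moran_mask (block_state t).1 x.
Proof.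
rewrite (block_stateP t).2; apply: eq_bigr => i _; apply: eq_norm_mask.
rewrite !normrM; congr (_ * _); rewrite normfV normr_nat normr_prod.
rewrite /block_denom natr_prod -prodfV; apply: eq_bigr => j _.
by rewrite normfV normrX natrX natr_absz intr_norm.
Qed.

(** The block number is monotone and grows once the r + 1 remaining letters are read. The products
    along the letters thus inherit the limit of the Moran masks. *)
Lemma block_state_cvg : (block_state t).1 @[t --> \oo] --> \oo.
Proof.
have mono t j : ((block_state t).1 <= (block_state (t + j)).1)%N.
  elim: j => [|j IH]; rewrite ?addn0// addnS/=.
  by move: IH; case: (block_state (t + j)) => k [|r]//= /leqW.
have advance r t k : block_state t = (k, r) -> (block_state (t + r.+1)).1 = k.+1.
  elim: r t k => [|r IH] t k E; first by rewrite addn1/= E.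
  by rewrite -addSnnS; apply: IH; rewrite /= E.
have reach A : exists t, (A <= (block_state t).1)%N.
  elim: A => [|A [t At]]; first by exists 0%N.
  exists (t + (block_state t).2.+1)%N.
  by rewrite (advance _ _ (block_state t).1)// -surjective_pairing.
apply/cvgnyPge => A; have [t At] := reach A; near=> s.
have ts : (t <= s)%N by near: s; exact: nbhs_infty_ge.
by rewrite (leq_trans At)// -(subnKC ts).
Unshelve. all: by end_near. Qed.

Theorem moran_spectrum (F : R -> R) :
  (forall x, moran_mask k x @[k --> \oo] --> F x) ->
  exists Lam : nat -> seq int,
  [/\ forall k, uniq (Lam k),
      forall k j, (k <= j)%N -> {subset Lam k <= Lam j},
      forall k l l', l \in Lam k -> l' \in Lam k -> l != l' ->
        F (l'%:~R - l%:~R) = 0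
    & forall x eps, 0 < eps ->
        exists k, 1 - eps <= \sum_(l <- Lam k) F (x + l%:~R)].
Proof.
move=> F_lim; have [C C0 hC] := letter_lipschitz; have [d hd] := letter_zeros.
apply: (@mask_spectrum _ _ letter_scale (fun c => mask (letter_digits c))
  _ _ _ _ _ C C0 hC _ d hd letter_spec _ _ letters).
- exact: letter_scale_ge2.
- by move=> c x; exact: mask_ge0.
- by move=> c x; exact/mask_le1/size_letter_digits.
- by move=> c; exact/mask0/size_letter_digits.
- by move=> c x z; exact: mask_periodic.
- by move=> c x; exact: letter_two_branches.
- exact: letter_spec0.
- exact: letter_spec_sum.
- move=> x; rewrite (_ : mask_prod _ _ _ ^~ x =
      (moran_mask ^~ x) \o (fun t => (block_state t).1)).
    by apply: cvg_comp block_state_cvg _; exact: F_lim.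
  by apply/funext => t; exact: mask_prod_letters.
Qed.

End Moran.

(** * Partial convolutions *)

Lemma big_ord_divmod (V : nmodType) (F : nat -> nat -> V) t b :
  \sum_(j < t * b) F (j %/ b)%N (j %% b)%N = \sum_(j < t) \sum_(i < b) F j i.
Proof.
case: b => [|b].
  by rewrite muln0 big_ord0 big1// => j _; rewrite big_ord0.
elim: t => [|t IH]; first by rewrite mul0n !big_ord0.
rewrite mulSnr big_split_ord [RHS]big_ord_recr/= IH; congr (_ + _).
apply: eq_bigr => i _.
by rewrite divnMDl// divn_small// addn0 modnMDl modn_small.
Qed.

Lemma funepos_EFin (R : realType) (T : Type) (g : T -> R) :
  ((fun x => (g x)%:E)^\+)%E = (fun x => (Num.max (g x) 0)%:E).
Proof. by apply/funext => x; rewrite funeposE -EFin_max. Qed.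

Lemma funeneg_EFin (R : realType) (T : Type) (g : T -> R) :
  ((fun x => (g x)%:E)^\-)%E = (fun x => (Num.max (- g x) 0)%:E).
Proof. by apply/funext => x; rewrite funenegE -EFinN -EFin_max. Qed.

Section PartialConvolution.
Variable R : realType.
Implicit Types (A : {fset R}) (f : R -> R).

Lemma integral_unif_dirac A f : measurable_fun setT f -> (forall x, 0 <= f x) ->
  (\int[unif_dirac A]_x (f x)%:E =
   (#|` A|%:R^-1 * \sum_(i < #|` A|) f A`_i)%:E)%E.
Proof.
move=> mf f0.
have mfE : measurable_fun setT (EFin \o f) by exact/measurable_EFinP.
rewrite (eq_measure_integral (mscale (#|` A|%:R^-1)%:nng
    (msum (fun k => \d_(A`_k) : {measure set R -> \bar R}) #|` A|))); last first.
  move=> S _ _ /=; rewrite /unif_dirac /mscale /= /msum.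
  by rewrite (big_nth 0) big_mkord.
rewrite ge0_integral_mscale//= ; last by move=> x _; rewrite lee_fin.
rewrite ge0_integral_measure_sum//; last by move=> x _; rewrite lee_fin.
rewrite EFinM -sumEFin; congr (_ * _)%E; apply: eq_bigr => i _.
by rewrite integral_dirac// diracT mul1e.
Qed.

Lemma integral_convolution (mu : {finite_measure set R -> \bar R}) A f :
  measurable_fun setT f -> (forall x, 0 <= f x) ->
  (\int[convolution mu (unif_dirac A)]_x (f x)%:E =
   \int[mu]_x (#|` A|%:R^-1 * \sum_(i < #|` A|) f (x + A`_i))%:E)%E.
Proof.
move=> mf f0.
have madd : measurable_fun [set: R * R] (fun p : R * R => p.1 + p.2).
  exact: measurable_realfun.measurable_funD.
have mfE : measurable_fun setT (EFin \o f) by exact/measurable_EFinP.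
rewrite ge0_integral_pushforward//=; last by move=> x _; rewrite lee_fin.
rewrite preimage_setT fubini_tonelli1//=; last 2 first.
- by apply/measurable_EFinP; apply: measurableT_comp.
- by move=> p; rewrite lee_fin.
apply: eq_integral => x _; rewrite /fubini_F/=.
rewrite (integral_unif_dirac A (f := fun y => f (x + y)))//.
by apply: measurableT_comp => //; exact: measurable_funD.
Qed.

(** The points, with repetitions, whose uniform average is the k-th partial convolution: j is read
    in mixed radix, its last digit choosing the summand in [A k]. *)
Fixpoint atom (A : nat -> {fset R}) k j : R :=
  if k is k'.+1 then
    atom A k' (j %/ #|` A k|)%N + (A k)`_(j %% #|` A k|)%N
  else (A 0%N)`_j.

Definition natoms (A : nat -> {fset R}) k : nat := \prod_(i < k.+1) #|` A i|.

Lemma integral_partial_convolution_ge0 (A : nat -> {fset R}) k f :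
  measurable_fun setT f -> (forall x, 0 <= f x) ->
  (\int[partial_convolution A k]_x (f x)%:E =
   ((natoms A k)%:R^-1 * \sum_(j < natoms A k) f (atom A k j))%:E)%E.
Proof.
elim: k f => [|k IH] f mf f0 /=.
  by rewrite integral_unif_dirac// /natoms big_ord1.
rewrite integral_convolution// IH; last 2 first.
- apply: measurable_funM => //; apply: measurable_sum => i.
  by apply: measurableT_comp => //; exact: measurable_funD.
- by move=> x; rewrite mulr_ge0// sumr_ge0.
rewrite /natoms [in RHS]big_ord_recr/= -/(natoms A k)
  (big_ord_divmod (fun j i => f (atom A k j + (A k.+1)`_i))).
by rewrite -mulr_sumr mulrA natrM invfM.
Qed.

Lemma integral_partial_convolution (A : nat -> {fset R}) k f :
  measurable_fun setT f ->
  (\int[partial_convolution A k]_x (f x)%:E =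
   ((natoms A k)%:R^-1 * \sum_(j < natoms A k) f (atom A k j))%:E)%E.
Proof.
move=> mf; rewrite integralE funepos_EFin funeneg_EFin.
rewrite !integral_partial_convolution_ge0; last 4 first.
- by apply: measurable_maxr => //; exact: measurableT_comp.
- by move=> x; rewrite le_max lexx orbT.
- exact: measurable_maxr.
- by move=> x; rewrite le_max lexx orbT.
rewrite -EFinB -mulrBr -sumrB; congr (_ * _)%:E; apply: eq_bigr => j _.
set y := f _; rewrite /Order.max; case: (ltP y 0); case: (ltP (- y) 0) => ? ?; lra.
Qed.

Lemma big_fset_ord A f : \sum_(a <- A) f a = \sum_(i < #|` A|) f A`_i.
Proof. by rewrite (big_nth 0) big_mkord. Qed.

(** The squared Fourier transform of [unif_dirac A] at x. *)
Definition fset_mask A (x : R) : R :=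
  ((\sum_(a <- A) cos (2 * pi * x * a)) ^+ 2 +
   (\sum_(a <- A) sin (2 * pi * x * a)) ^+ 2) / #|` A|%:R ^+ 2.

(** Multiplicativity of the squared Fourier transform under convolution: the addition formulas give
    the product of two complex numbers, and |z w|^2 = |z|^2 |w|^2. *)
Lemma atom_mask (A : nat -> {fset R}) k x :
  ((natoms A k)%:R^-1 * \sum_(j < natoms A k) cos (2 * pi * x * atom A k j)) ^+ 2 +
  ((natoms A k)%:R^-1 * \sum_(j < natoms A k) sin (2 * pi * x * atom A k j)) ^+ 2 =
  \prod_(i < k.+1) fset_mask (A i) x.
Proof.
elim: k => [|k IH].
  rewrite big_ord1 /natoms big_ord1 /fset_mask !big_fset_ord /=.
  rewrite !exprMn -mulrDr mulrC exprVn //.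
rewrite big_ord_recr/= -IH /natoms [in LHS]big_ord_recr/= -/(natoms A k) -/natoms.
rewrite (big_ord_divmod (fun j i => cos (2 * pi * x * (atom A k j + (A k.+1)`_i)))).
rewrite (big_ord_divmod (fun j i => sin (2 * pi * x * (atom A k j + (A k.+1)`_i)))).
rewrite /fset_mask !big_fset_ord.
set t := natoms A k; set b := #|` A k.+1|.
pose u j := 2 * pi * x * atom A k j; pose v i := 2 * pi * x * (A k.+1)`_i.
have -> : \sum_(j < t) \sum_(i < b) cos (2 * pi * x * (atom A k j + (A k.+1)`_i)) =
    (\sum_(j < t) cos (u j)) * (\sum_(i < b) cos (v i)) -
    (\sum_(j < t) sin (u j)) * (\sum_(i < b) sin (v i)).
  rewrite !mulr_suml -sumrB; apply: eq_bigr => j _; rewrite !mulr_sumr -sumrB.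
  by apply: eq_bigr => i _; rewrite mulrDr cosD.
have -> : \sum_(j < t) \sum_(i < b) sin (2 * pi * x * (atom A k j + (A k.+1)`_i)) =
    (\sum_(j < t) sin (u j)) * (\sum_(i < b) cos (v i)) +
    (\sum_(j < t) cos (u j)) * (\sum_(i < b) sin (v i)).
  rewrite !mulr_suml -big_split; apply: eq_bigr => j _; rewrite !mulr_sumr -big_split.
  by apply: eq_bigr => i _; rewrite mulrDr sinD.
rewrite natrM invfM -!exprVn; set p := t%:R^-1; set q := b%:R^-1; ring.
Qed.

End PartialConvolution.

(** * Squared Fourier transform of the limit *)

Section FourierSquare.
Variable R : realType.

Definition fourier_sq (mu : probability R R) (x : R) : R :=
  Rintegral mu setT (fun y => cos (2 * pi * x * y)) ^+ 2 +
  Rintegral mu setT (fun y => sin (2 * pi * x * y)) ^+ 2.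

(** Weak convergence is tested on the bounded continuous functions cos and sin. *)
Lemma cvg_fourier_sq (A : nat -> {fset R}) (mu : probability R R) :
  is_infinite_convolution A mu ->
  forall x, \prod_(i < k.+1) fset_mask (A i) x @[k --> \oo] --> fourier_sq mu x.
Proof.
move=> Amu x.
have bound_trig (f : R -> R) : continuous f -> (forall y, `|f y| <= 1) ->
    (natoms A k)%:R^-1 * \sum_(j < natoms A k) f (atom A k j) @[k --> \oo] -->
    Rintegral mu setT f.
  move=> cf f1; have bf : bounded_fun f.
    by exists 1; split => // M M1 y _; exact: le_trans (f1 y) (ltW M1).
  have mf : measurable_fun setT f by apply: continuous_measurable_fun.
  have intf : mu.-integrable setT (EFin \o f).
    apply: (@le_integrable _ _ _ mu setT _ _ (cst 1%E)) => //.
    - exact/measurable_EFinP.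
    - by move=> y _; rewrite /= lee_fin normr1.
    - exact: finite_measure_integrable_cst.
  have := Amu f cf bf; rewrite -[X in _ --> X]fineK; last first.
    exact: integrable_fin_num.
  move=> /fine_cvg h; apply: cvg_trans h; apply: near_eq_cvg.
  by near=> k; rewrite /= integral_partial_convolution.
have cc : continuous (fun y : R => 2 * pi * x * y) by exact: mulrl_continuous.
rewrite (_ : (fun k => _) = fun k =>
    ((natoms A k)%:R^-1 * \sum_(j < natoms A k) cos (2 * pi * x * atom A k j)) ^+ 2 +
    ((natoms A k)%:R^-1 * \sum_(j < natoms A k) sin (2 * pi * x * atom A k j)) ^+ 2).
  apply: cvgD.
    apply: (cvg_comp _ (fun y : R => y ^+ 2)); last exact: exprn_continuous.
    apply: (bound_trig (fun y => cos (2 * pi * x * y))) => [y|y].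
      by apply: continuous_comp; [exact: cc|exact: continuous_cos].
    exact: cos_max.
  apply: (cvg_comp _ (fun y : R => y ^+ 2)); last exact: exprn_continuous.
  apply: (bound_trig (fun y => sin (2 * pi * x * y))) => [y|y].
    by apply: continuous_comp; [exact: cc|exact: continuous_sin].
  exact: sin_max.
by apply/funext => k; rewrite atom_mask.
Unshelve. all: by end_near. Qed.

End FourierSquare.

(** * Existence of the infinite convolution *)

Section Existence.
Variables (R : realType) (A : nat -> {fset R}).
Hypothesis A_gt0 : forall k, (0 < #|` A k|)%N.
Variable D : R.
Hypothesis A_bound : forall k a, a \in A k -> `|a| <= D / 2 ^+ k.

Let cell (k j : nat) : set R :=
  `[j%:R / (natoms A k)%:R, j.+1%:R / (natoms A k)%:R[.

(* The law of step k under the uniform distribution on [0, 1[ is the k-th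
   partial convolution. *)
Definition step k (u : R) : R :=
  \sum_(j < natoms A k) atom A k j * \1_(cell k j) u.

Lemma natoms_gt0 k : (0 < natoms A k)%N.
Proof. by rewrite /natoms prodn_gt0. Qed.

Let t0 k : 0 < (natoms A k)%:R :> R.
Proof. by rewrite ltr0n natoms_gt0. Qed.

Lemma cellP k j u : cell k j u <->
  j%:R <= u * (natoms A k)%:R /\ u * (natoms A k)%:R < j.+1%:R.
Proof.
rewrite /cell /= in_itv/= ler_pdivrMr// ltr_pdivlMr//.
by split=> [/andP[]|[-> ->]].
Qed.

Lemma cell_inj k i j u : cell k i u -> cell k j u -> i = j.
Proof.
move=> /cellP[h1 h2] /cellP[h3 h4].
have := le_lt_trans h1 h4; have := le_lt_trans h3 h2.
by rewrite !ltr_nat => ? ?; lia.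
Qed.

Lemma cell_cover k u : 0 <= u < 1 -> exists2 j, (j < natoms A k)%N & cell k j u.
Proof.
move=> /andP[u0 u1]; have ut0 : 0 <= u * (natoms A k)%:R by rewrite mulr_ge0.
have /andP[h1 h2] := truncn_itv ut0.
exists (Num.truncn (u * (natoms A k)%:R)); last exact/cellP.
rewrite -(ltr_nat R); apply: le_lt_trans h1 _.
by rewrite gtr_pMl.
Qed.

Lemma cell_in01 k j u : (j < natoms A k)%N -> cell k j u -> 0 <= u < 1.
Proof.
move=> jt /cellP[h1 h2]; apply/andP; split.
  by rewrite -(pmulr_lge0 _ (t0 k)); exact: le_trans h1.
rewrite -(ltr_pM2r (t0 k)) mul1r; apply: lt_le_trans h2 _.
by rewrite ler_nat.
Qed.

Lemma stepE k j u : (j < natoms A k)%N -> cell k j u -> step k u = atom A k j.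
Proof.
move=> jt cj; rewrite /step (bigD1 (Ordinal jt))//= indicE mem_set// mulr1.
rewrite big1 ?addr0// => i /negP ij; rewrite indicE memNset ?mulr0// => ci.
by apply: ij; apply/eqP/val_inj; exact: cell_inj ci cj.
Qed.

Lemma step_out k u : ~ (0 <= u < 1) -> step k u = 0.
Proof.
move=> u01; rewrite /step big1// => j _; rewrite indicE memNset ?mulr0// => cj.
by apply: u01; exact: cell_in01 cj.
Qed.

Lemma D_ge0 : 0 <= D.
Proof.
have h : (A 0%N)`_0 \in A 0%N by rewrite mem_nth.
by have := A_bound h; rewrite expr0 divr1; exact: le_trans.
Qed.

(** On [0, 1[, cell j of level k + 1 lies in cell j / b of level k, and [atom] recurses by the same
    division, so the two values differ by one element of [A k.+1]. *)
Lemma step_close k u : `|step k.+1 u - step k u| <= D / 2 ^+ k.+1.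
Proof.
have [u01|u01] := boolP (0 <= u < 1); last first.
  rewrite !step_out ?subrr ?normr0; [|exact/negP..].
  by rewrite divr_ge0 ?exprn_ge0 ?D_ge0.
have [j jt cj] := cell_cover k.+1 u01; set b := #|` A k.+1|.
have b0 : (0 < b)%N by exact: A_gt0.
have tE : natoms A k.+1 = (natoms A k * b)%N by rewrite /natoms big_ord_recr.
have jbt : (j %/ b < natoms A k)%N by rewrite ltn_divLR// -tE.
have cjb : cell k (j %/ b)%N u.
  have := cj => /cellP[]; rewrite tE natrM mulrA => h1 h2; apply/cellP.
  have b0' : 0 < b%:R :> R by rewrite ltr0n.
  split; rewrite -(ler_pM2r b0', ltr_pM2r b0') -natrM.
    by apply: le_trans h1; rewrite ler_nat leq_trunc_div.
  by apply: lt_le_trans h2 _; rewrite ler_nat -ltn_divLR.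
rewrite (stepE jt cj) (stepE jbt cjb) /= -/b addrAC subrr add0r.
by apply: A_bound; rewrite mem_nth// ltn_mod.
Qed.

Lemma measurable_step k : measurable_fun setT (step k).
Proof.
apply: measurable_sum => j; apply: measurable_funM => //.
by apply: measurable_indic; exact: measurable_itv.
Qed.

Definition step_limit u : R := limn (step ^~ u).

(** The increments are at most D / 2^(k+1), so the telescoping series converges absolutely. *)
Lemma step_cvg u : step k u @[k --> \oo] --> step_limit u.
Proof.
suff : cvgn (step ^~ u) by [].
have -> : step ^~ u = (fun k => step 0 u + series (telescope (step ^~ u)) k).
  by apply/funext => k; exact: (eq_sum_telescope (step ^~ u) k).
apply: is_cvgD; first exact: is_cvg_cst.
apply: normed_cvg.
apply: (@series_le_cvg _ _ (geometric (D / 2) (2^-1))) => [k|k|k|].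
- exact: normr_ge0.
- by rewrite /geometric/= mulr_ge0 ?exprn_ge0 ?divr_ge0 ?D_ge0.
- rewrite /telescope /geometric/=; apply: le_trans (step_close k u) _.
  by rewrite exprS invfM exprVn mulrA.
- apply: is_cvg_geometric_series.
  by rewrite ger0_norm// invf_lt1// ltr1n.
Qed.

Lemma measurable_step_limit : measurable_fun setT step_limit.
Proof.
apply: (measurable_fun_cvg (h := step)) => [k|u _]; first exact: measurable_step.
exact: step_cvg.
Qed.

Lemma lebesgue_cell k j : (j < natoms A k)%N ->
  lebesgue_measure (cell k j) = ((natoms A k)%:R^-1)%:E.
Proof.
move=> jt; rewrite /cell lebesgue_measure_itv/= lte_fin ltr_pM2r ?invr_gt0//.
by rewrite ltr_nat ltnSn -EFinB -mulrBl -natrB// subSnn mul1r.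
Qed.

Lemma integral_step_ge0 k (f : R -> R) : measurable_fun setT f ->
  (forall x, 0 <= f x) ->
  (\int[uniform_prob (@ltr01 R)]_u (f (step k u))%:E =
   ((natoms A k)%:R^-1 * \sum_(j < natoms A k) f (atom A k j))%:E)%E.
Proof.
move=> mf f0.
have mfs : measurable_fun setT (EFin \o (f \o step k)).
  by apply/measurable_EFinP; apply: measurableT_comp => //; exact: measurable_step.
rewrite integral_uniform//; last by move=> x; rewrite lee_fin.
(* The uniform law lives on [0, 1] while the cells cover [0, 1[; the endpoint has measure zero. *)
rewrite subr0 invr1 mul1e -integral_itv_bndo_bndc; last exact: measurable_funTS.
transitivity (\int[lebesgue_measure]_(u in `[0%R, 1%R[)
    \sum_(j < natoms A k) (f (atom A k j) * \1_(cell k j) u)%:E)%E.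
  apply: eq_integral => u; rewrite inE/= in_itv/= => u01.
  have [j jt cj] := cell_cover k u01.
  rewrite (stepE jt cj) (bigD1 (Ordinal jt))//= indicE mem_set// mulr1.
  rewrite big1 ?adde0// => i /negP ij; rewrite indicE memNset ?mulr0// => ci.
  by apply: ij; apply/eqP/val_inj; exact: cell_inj ci cj.
rewrite ge0_integral_sum//; last 2 first.
- move=> j; apply/measurable_EFinP; apply: measurable_funM => //.
  by apply: measurable_indic; exact: measurable_itv.
- by move=> j u _; rewrite lee_fin mulr_ge0.
rewrite EFinM -sumEFin ge0_sume_distrr => [|j _]; last by rewrite lee_fin.
apply: eq_bigr => j _.
under eq_integral do rewrite EFinM.
rewrite ge0_integralZl//; last 2 first.
- by apply/measurable_EFinP; apply: measurable_indic; exact: measurable_itv.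
- by rewrite lee_fin.
rewrite integral_indic//; last exact: measurable_itv.
rewrite (_ : cell k j `&` _ = cell k j).
  by rewrite muleC; congr (_ * _)%E; exact: lebesgue_cell.
by apply: setIidl => u cu; rewrite /= in_itv/=; exact: cell_in01 cu.
Qed.

Lemma integral_step k (f : R -> R) : measurable_fun setT f ->
  (\int[partial_convolution A k]_x (f x)%:E =
   \int[uniform_prob (@ltr01 R)]_u (f (step k u))%:E)%E.
Proof.
move=> mf; rewrite integralE [RHS]integralE !funepos_EFin !funeneg_EFin.
have mp : measurable_fun setT (fun x => Num.max (f x) 0) by exact: measurable_maxr.
have mn : measurable_fun setT (fun x => Num.max (- f x) 0).
  by apply: measurable_maxr => //; exact: measurableT_comp.
rewrite !integral_partial_convolution_ge0//; last 2 first.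
- by move=> x; rewrite le_max lexx orbT.
- by move=> x; rewrite le_max lexx orbT.
rewrite (integral_step_ge0 k mp); last by move=> x; rewrite le_max lexx orbT.
by rewrite (integral_step_ge0 k mn)// => x; rewrite le_max lexx orbT.
Qed.

(** The limit is the law of the pointwise limit of the steps: all partial convolutions are laws on
    one probability space, so dominated convergence applies. *)
Theorem infinite_convolution_exists :
  exists mu : probability R R, is_infinite_convolution A mu.
Proof.
have mX : measurable_fun [set: measurableTypeR R] step_limit.
  exact: measurable_step_limit.
pose X : {mfun measurableTypeR R >-> R} :=
  @mfun_Sub _ _ (measurableTypeR R) R step_limit (mem_set mX).
pose P := uniform_prob (@ltr01 R).
exists (distribution P X) => f cf [M [_ hM]].
(* [bounded_fun] provides a bound by every number above M, such as M + 1. *)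
have fM x : `|f x| <= M + 1 by apply: hM => //; rewrite ltrDl.
have mf : measurable_fun setT f by exact: continuous_measurable_fun.
have iM : P.-integrable setT (cst (M + 1)%:E).
  exact: finite_measure_integrable_cst.
have mfX : measurable_fun setT (fun u : measurableTypeR R => (f (step_limit u))%:E).
  by apply/measurable_EFinP; apply: measurableT_comp.
have -> : (\int[distribution P X]_x (f x)%:E = \int[P]_u (f (step_limit u))%:E)%E.
  rewrite integral_distribution//; first exact/measurable_EFinP.
  apply: (le_integrable _ _ _ iM) => //= u _.
  by rewrite lee_fin (le_trans (fM _))// ler_norm.
have -> : (fun k => \int[partial_convolution A k]_x (f x)%:E)%E =
    (fun k => \int[P]_u (f (step k u))%:E)%E.
  by apply/funext => k; rewrite integral_step.
have mfs k : measurable_fun setT (fun u : measurableTypeR R => (f (step k u))%:E).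
  apply/measurable_EFinP; apply: measurableT_comp => //.
  exact: measurable_step.
have lim_ae : {ae P, forall u : measurableTypeR R, setT u ->
    (f (step k u))%:E @[k --> \oo] --> (f (step_limit u))%:E}.
  apply: aeW => u _; apply: cvg_EFin; first by near=> k.
  by apply: (cvg_comp _ f (@step_cvg u)); exact: cf.
have dom_ae : {ae P, forall (u : measurableTypeR R) k, setT u ->
    (`|(f (step k u))%:E| <= cst (M + 1)%:E u)%E}.
  by apply: aeW => u k _; rewrite /= lee_fin.
by have [] := dominated_convergence measurableT mfs mfX lim_ae iM dom_ae.
Unshelve. all: by end_near. Qed.

End Existence.

(** * Approximation in L2 by exponentials *)

Section Density.
Variables (R : realType) (mu : probability R R).
Implicit Types (f g : R -> R[i]) (z w : R[i]) (x eta : R).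

Definition normsq z : R := complex.Re z ^+ 2 + complex.Im z ^+ 2.

Lemma normsq_ge0 z : 0 <= normsq z.
Proof. by rewrite addr_ge0 ?sqr_ge0. Qed.

Lemma normsqM z w : normsq (z * w) = normsq z * normsq w.
Proof. by case: z => a b; case: w => c d; rewrite /normsq/=; ring. Qed.

Lemma normsqD_le z w : normsq (z + w) <= 2 * normsq z + 2 * normsq w.
Proof.
case: z => a b; case: w => c d; rewrite /normsq/=.
have := sqr_ge0 (a - c); have := sqr_ge0 (b - d); nra.
Qed.

Lemma normcE z : normc z = Num.sqrt (normsq z).
Proof. by case: z. Qed.

Lemma normsq_exponential eta x : normsq (exponential eta x) = 1.
Proof. by rewrite /normsq/= cos2Dsin2. Qed.

Lemma normsq_real (a : R) : normsq a%:C = a ^+ 2.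
Proof. by rewrite /normsq/= expr0n addr0. Qed.

Lemma cmeasurableD f g :
  cmeasurable f -> cmeasurable g -> cmeasurable (fun x => f x + g x).
Proof.
move=> [f1 f2] [g1 g2]; split.
  rewrite (_ : (fun x => _) = (fun x => complex.Re (f x) + complex.Re (g x))).
    exact: measurable_funD.
  by apply/funext => x; rewrite raddfD.
rewrite (_ : (fun x => _) = (fun x => complex.Im (f x) + complex.Im (g x))).
  exact: measurable_funD.
by apply/funext => x; rewrite raddfD.
Qed.

Lemma cmeasurableM f g :
  cmeasurable f -> cmeasurable g -> cmeasurable (fun x => f x * g x).
Proof.
move=> [f1 f2] [g1 g2]; split.
  rewrite (_ : (fun x => _) = (fun x => complex.Re (f x) * complex.Re (g x) -
      complex.Im (f x) * complex.Im (g x))).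
    by apply: measurable_funB; exact: measurable_funM.
  by apply/funext => x; case: (f x) (g x) => ? ? [].
rewrite (_ : (fun x => _) = (fun x => complex.Re (f x) * complex.Im (g x) +
    complex.Im (f x) * complex.Re (g x))).
  by apply: measurable_funD; exact: measurable_funM.
by apply/funext => x; case: (f x) (g x) => ? ? [].
Qed.

Lemma cmeasurable_cst z : cmeasurable (fun _ => z).
Proof. by split; exact: measurable_cst. Qed.

Lemma cmeasurable_real (h : R -> R) :
  measurable_fun setT h -> cmeasurable (fun x => (h x)%:C).
Proof. by move=> mh; split => //=; exact: measurable_cst. Qed.

Lemma cmeasurableN f : cmeasurable f -> cmeasurable (fun x => - f x).
Proof.
move=> mf; rewrite (_ : (fun x => _) = (fun x => (-1) * f x)).
  by apply: cmeasurableM => //; exact: cmeasurable_cst.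
by apply/funext => x; rewrite mulN1r.
Qed.

Lemma cmeasurableB f g :
  cmeasurable f -> cmeasurable g -> cmeasurable (fun x => f x - g x).
Proof. by move=> mf mg; apply: cmeasurableD => //; exact: cmeasurableN. Qed.

Lemma cmeasurable_exponential eta : cmeasurable (exponential eta).
Proof.
split; apply: continuous_measurable_fun => x; apply: continuous_comp.
- exact: mulrl_continuous.
- exact: continuous_cos.
- exact: mulrl_continuous.
- exact: continuous_sin.
Qed.

Lemma cmeasurable_sum (I : Type) (s : seq I) (F : I -> R -> R[i]) :
  (forall i, cmeasurable (F i)) -> cmeasurable (fun x => \sum_(i <- s) F i x).
Proof.
move=> mF; elim: s => [|i s IH].
  by under eq_fun do rewrite big_nil; exact: cmeasurable_cst.
by under eq_fun do rewrite big_cons; exact: cmeasurableD.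
Qed.

Lemma measurable_normsq f :
  cmeasurable f -> measurable_fun setT (fun x => normsq (f x)).
Proof.
by move=> [f1 f2]; apply: measurable_funD; exact: measurable_funX.
Qed.

Definition L2sq f : \bar R := (\int[mu]_x (normsq (f x))%:E)%E.

Lemma L2sq_ge0 f : (0 <= L2sq f)%E.
Proof. by apply: integral_ge0 => x _; rewrite lee_fin normsq_ge0. Qed.

Lemma L2norm_sqE f : (L2norm mu f `^ 2 = L2sq f)%E.
Proof.
rewrite /L2norm powR_Lnorm ?pnatr_eq0//; apply: eq_integral => x _.
rewrite normcE abse_EFin ger0_norm ?sqrtr_ge0// poweR_EFin.
by rewrite powR_mulrn ?sqrtr_ge0// sqr_sqrtr ?normsq_ge0.
Qed.

Lemma L2norm_lt f (eps : R) : 0 < eps ->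
  (L2sq f < (eps ^+ 2)%:E)%E -> (L2norm mu f < eps%:E)%E.
Proof.
move=> e0; rewrite -L2norm_sqE.
have := Lnorm_ge0 mu 2%:E (fun x => (normc (f x))%:E).
rewrite -/(L2norm mu f); case: (L2norm mu f) => [r||]//=.
- rewrite lee_fin => r0; rewrite !lte_fin powR_mulrn//.
  by rewrite ltr_pXn2r// ?nnegrE// ltW.
- by rewrite pnatr_eq0/=.
Qed.

Lemma L2norm_fin f : (L2norm mu f < +oo)%E -> (L2sq f < +oo)%E.
Proof. by rewrite -L2norm_sqE; exact: poweR_lty. Qed.

Lemma L2sq_fin f : (L2sq f < +oo)%E -> (L2norm mu f < +oo)%E.
Proof. by rewrite -L2norm_sqE; apply: lty_poweRy; rewrite pnatr_eq0. Qed.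

Lemma measurable_normsqE f : cmeasurable f ->
  measurable_fun setT (fun x => (normsq (f x))%:E).
Proof. by move=> mf; apply/measurable_EFinP; exact: measurable_normsq. Qed.

(** A triangle inequality up to constants for the squared norm, from |z + w|^2 <= 2 |z|^2 + 2
    |w|^2. *)
Lemma L2sqD_le f g : cmeasurable f -> cmeasurable g ->
  (L2sq (fun x => f x + g x)%R <= 2%:E * L2sq f + 2%:E * L2sq g)%E.
Proof.
move=> mf mg; rewrite /L2sq.
have m2 h : cmeasurable h -> measurable_fun setT (fun x => 2%:E * (normsq (h x))%:E)%E.
  move=> mh; apply/measurable_EFinP; apply: measurable_funM => //.
  exact: measurable_normsq.
rewrite -!ge0_integralZl//; try by move=> *; rewrite lee_fin ?normsq_ge0.
- rewrite -ge0_integralD//; try exact: m2;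
    try by move=> *; rewrite -EFinM lee_fin mulr_ge0 ?normsq_ge0.
  apply: ge0_le_integral => //.
  + by move=> x _; rewrite lee_fin normsq_ge0.
  + by apply: measurable_normsqE; exact: cmeasurableD.
  + by apply: emeasurable_funD; exact: m2.
  + by move=> x _; rewrite -!EFinM -EFinD lee_fin normsqD_le.
- exact: measurable_normsqE.
- exact: measurable_normsqE.
Qed.

Lemma L2sqZ z f : cmeasurable f ->
  (L2sq (fun x => z * f x)%R = (normsq z)%:E * L2sq f)%E.
Proof.
move=> mf; rewrite /L2sq -ge0_integralZl//.
- by apply: eq_integral => x _; rewrite normsqM.
- exact: measurable_normsqE.
- by move=> x _; rewrite lee_fin normsq_ge0.
- by rewrite lee_fin normsq_ge0.
Qed.

Variable D : set R.

Definition spanned g := exists (s : {fset R}) (c : R -> R[i]),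
  [set` s] `<=` D /\ g = fun x => \sum_(i <- s) c i * exponential i x.

Lemma spanned_measurable g : spanned g -> cmeasurable g.
Proof.
move=> [s [c [_ ->]]]; apply: cmeasurable_sum => i.
by apply: cmeasurableM; [exact: cmeasurable_cst | exact: cmeasurable_exponential].
Qed.

Lemma spanned0 : spanned (fun=> 0).
Proof.
exists fset0, (fun=> 0); split => [x //|].
by apply/funext => x; rewrite big_seq_fset0.
Qed.

Lemma spannedZ z g : spanned g -> spanned (fun x => z * g x).
Proof.
move=> [s [c [sD ->]]]; exists s, (fun i => z * c i); split => //.
by apply/funext => x; rewrite mulr_sumr; apply: eq_bigr => i _; rewrite mulrA.
Qed.

Lemma spannedD f g : spanned f -> spanned g -> spanned (fun x => f x + g x).
Proof.
move=> [s [c [sD ->]]] [t [d [tD ->]]].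
(* Coefficients are extended by 0 to the union of the two sets of frequencies. *)
pose ext (u : {fset R}) (a : R -> R[i]) i := if i \in u then a i else 0.
exists (s `|` t)%fset, (fun i => ext s c i + ext t d i); split.
  by move=> x /=; rewrite in_fsetU => /orP[/sD|/tD].
have extE (u : {fset R}) a x : (u `<=` s `|` t)%fset ->
    \sum_(i <- u) a i * exponential i x =
    \sum_(i <- (s `|` t)%fset) ext u a i * exponential i x.
  move=> us; rewrite [LHS]big_seq (eq_bigr (fun i => ext u a i * exponential i x)).
    rewrite -big_seq; apply: big_fset_incl => // i _ /negbTE iu.
    by rewrite /ext iu mul0r.
  by move=> i iu; rewrite /ext iu.
apply/funext => x; rewrite (extE s)// ?fsubsetUl// (extE t)// ?fsubsetUr//.
by rewrite -big_split; apply: eq_bigr => i _; rewrite mulrDl.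
Qed.

(** Membership in the L2 closure of the span of the exponentials with frequencies in D. *)
Definition approximable f := cmeasurable f /\
  forall eps : R, 0 < eps ->
    exists2 g, spanned g & (L2sq (fun x => f x - g x)%R < eps%:E)%E.

Lemma approximable_lim f : cmeasurable f ->
  (forall eps : R, 0 < eps ->
    exists2 g, approximable g & (L2sq (fun x => f x - g x)%R < eps%:E)%E) ->
  approximable f.
Proof.
(* A quarter of eps, because [L2sqD_le] doubles both terms. *)
move=> mf h; split => // eps e0; have e4 : 0 < eps / 4 by rewrite divr_gt0.
have [g [mg gapp] fg] := h _ e4; have [k ks gk] := gapp _ e4.
exists k => //; have mk := spanned_measurable ks.
rewrite (_ : (fun x => _) = (fun x => (f x - g x) + (g x - k x))); last first.
  by apply/funext => x; rewrite subrKA.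
apply: le_lt_trans (L2sqD_le (cmeasurableB mf mg) (cmeasurableB mg mk)) _.
rewrite (_ : eps%:E = 2%:E * (eps / 4)%:E + 2%:E * (eps / 4)%:E)%E; last first.
  by rewrite -!EFinM -EFinD; congr EFin; lra.
by apply: lteD; rewrite lte_pmul2l.
Qed.

Lemma approximableD f g :
  approximable f -> approximable g -> approximable (fun x => f x + g x).
Proof.
move=> [mf fapp] [mg gapp]; split; first exact: cmeasurableD.
move=> eps e0; have e4 : 0 < eps / 4 by rewrite divr_gt0.
have [f' fs ff'] := fapp _ e4; have [g' gs gg'] := gapp _ e4.
exists (fun x => f' x + g' x); first exact: spannedD.
rewrite (_ : (fun x => _) = (fun x => (f x - f' x) + (g x - g' x))); last first.
  by apply/funext => x; rewrite opprD addrACA.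
have mf' := spanned_measurable fs; have mg' := spanned_measurable gs.
apply: le_lt_trans (L2sqD_le (cmeasurableB mf mf') (cmeasurableB mg mg')) _.
rewrite (_ : eps%:E = 2%:E * (eps / 4)%:E + 2%:E * (eps / 4)%:E)%E; last first.
  by rewrite -!EFinM -EFinD; congr EFin; lra.
by apply: lteD; rewrite lte_pmul2l.
Qed.

Lemma approximableZ z f : approximable f -> approximable (fun x => z * f x).
Proof.
move=> [mf fapp]; split.
  by apply: cmeasurableM => //; exact: cmeasurable_cst.
(* The added 1 covers z = 0. *)
move=> eps e0; have z1 : 0 < normsq z + 1 by rewrite ltr_wpDl ?normsq_ge0.
have [g gs fg] := fapp _ (divr_gt0 e0 z1).
exists (fun x => z * g x); first exact: spannedZ.
rewrite (_ : (fun x => _) = (fun x => z * (f x - g x))); last first.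
  by apply/funext => x; rewrite mulrBr.
rewrite L2sqZ; last first.
  by apply: cmeasurableB => //; exact: spanned_measurable.
apply: le_lt_trans (_ : _ <= (normsq z + 1)%:E * L2sq (fun x => f x - g x)%R)%E _.
  by apply: lee_wpmul2r; [exact: L2sq_ge0 | rewrite lee_fin lerDl].
by rewrite muleC -lte_pdivlMr// -EFinM.
Qed.

Lemma approximable_sum (I : Type) (s : seq I) (F : I -> R -> R[i]) :
  (forall i, approximable (F i)) -> approximable (fun x => \sum_(i <- s) F i x).
Proof.
move=> aF; elim: s => [|i s IH].
  under eq_fun do rewrite big_nil; split; first exact: cmeasurable_cst.
  move=> eps e0; exists (fun=> 0); first exact: spanned0.
  rewrite /L2sq (eq_integral (cst 0%E)) ?integral0 ?lte_fin// => x _.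
  by rewrite subrr /normsq/= expr0n addr0.
by under eq_fun do rewrite big_cons; exact: approximableD.
Qed.

Lemma approximable_dominated (F : nat -> R -> R[i]) f (G : R -> R) :
  (forall n, approximable (F n)) -> cmeasurable f ->
  mu.-integrable setT (fun x => (G x)%:E) ->
  (forall n x, normsq (f x - F n x) <= G x) ->
  (forall x, normsq (f x - F n x) @[n --> \oo] --> 0) ->
  approximable f.
Proof.
move=> aF mf iG FG Ff; apply: approximable_lim => // eps e0.
have mfF n : cmeasurable (fun x => f x - F n x).
  by apply: cmeasurableB => //; case: (aF n).
have lim_ae : {ae mu, forall x, setT x ->
    (normsq (f x - F n x))%:E @[n --> \oo] --> 0%E}.
  apply: aeW => x _; apply: cvg_EFin; first by near=> k.
  exact: Ff.
have dom_ae : {ae mu, forall x n, setT x ->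
    (`|(normsq (f x - F n x))%:E| <= (G x)%:E)%E}.
  by apply: aeW => x n _; rewrite abse_EFin ger0_norm ?normsq_ge0// lee_fin.
have [_ _] := dominated_convergence measurableT
  (fun n => measurable_normsqE (mfF n)) (measurable_cst _) lim_ae iG dom_ae.
rewrite integral0 => /fine_cvgP[_] h.
have := cvgr_lt _ h _ e0.
case=> N _ /(_ N (leqnn N))/= hN; exists (F N) => //.
have fin : (L2sq (fun x => f x - F N x)%R < +oo)%E.
  apply: le_lt_trans (_ : _ <= \int[mu]_x (G x)%:E)%E _.
    apply: ge0_le_integral => //.
    - by move=> x _; rewrite lee_fin normsq_ge0.
    - exact: measurable_normsqE.
    - by case/integrableP : iG.
    - by move=> x _; rewrite lee_fin.
  by rewrite ltey_eq integrable_fin_num.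
by rewrite -[L2sq _]fineK ?lte_fin// ge0_fin_numE ?L2sq_ge0.
Unshelve. all: by end_near. Qed.

(** * From exponentials to all of L2 *)

Hypothesis approximable_exponential : forall eta, approximable (exponential eta).

Implicit Types (h : R -> R) (a theta : R).

(** Asking for every eta at once makes the class stable under multiplication by sines; boundedness
    gives constant majorants for limits. *)
Definition tame h := [/\ measurable_fun setT h, (exists M, forall x, `|h x| <= M)
  & forall eta, approximable (fun x => (h x)%:C * exponential eta x)].

Lemma exponentialD eta zeta x :
  exponential eta x * exponential zeta x = exponential (eta + zeta) x.
Proof. by rewrite /exponential -expiD; congr expi; ring. Qed.

Lemma exponential0 x : exponential 0 x = 1.
Proof. by rewrite /exponential mulr0 mul0r expi0. Qed.

Lemma tame1 : tame (fun=> 1).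
Proof.
split; first exact: measurable_cst.
  by exists 1 => x; rewrite normr1.
by move=> eta; under eq_fun do rewrite mul1r; exact: approximable_exponential.
Qed.

Lemma tameD h k : tame h -> tame k -> tame (fun x => h x + k x).
Proof.
move=> [mh [M hM] ah] [mk [M' kM'] ak]; split; first exact: measurable_funD.
  exists (M + M') => x; apply: le_trans (ler_normD _ _) _.
  by rewrite lerD.
move=> eta; rewrite (_ : (fun x => _) = fun x =>
  (h x)%:C * exponential eta x + (k x)%:C * exponential eta x).
  exact: approximableD.
by apply/funext => x; rewrite rmorphD mulrDl.
Qed.

Lemma tameZ (c : R) h : tame h -> tame (fun x => c * h x).
Proof.
move=> [mh [M hM] ah]; split; first exact: measurable_funM.
  by exists (`|c| * M) => x; rewrite normrM ler_wpM2l.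
move=> eta; under eq_fun do rewrite rmorphM -mulrA.
exact: approximableZ.
Qed.

(* Multiplying by e^{i t} only shifts the frequency eta. *)
Lemma tame_sin theta a h :
  tame h -> tame (fun x => h x * sin (theta * (x - a))).
Proof.
move=> [mh [M hM] ah]; split.
- apply: measurable_funM => //; apply: continuous_measurable_fun => x.
  apply: (@continuous_comp _ _ _ (fun x => theta * (x - a)) sin).
    apply: continuous_comp; last exact: mulrl_continuous.
    by apply: cvgD; [exact: cvg_id | exact: cvg_cst].
  exact: continuous_sin.
- exists M => x; rewrite normrM; apply: le_trans (hM x).
  by rewrite ler_piMr// sin_max.
move=> eta; set zeta := theta / (2 * pi).
have pi0 : (pi : R) != 0 by rewrite gt_eqF ?pi_gt0.
(* sin y = (e^{iy} - e^{-iy}) / (2i), where 1 / (2i) is [0 -i* 2^-1]. *)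
rewrite (_ : (fun x => _) = fun x =>
    (0 -i* 2^-1) * expi (- (theta * a)) * ((h x)%:C * exponential (eta + zeta) x) +
    (0 +i* 2^-1) * expi (theta * a) * ((h x)%:C * exponential (eta - zeta) x)).
  by apply: approximableD; exact: approximableZ.
apply/funext => x; rewrite -!exponentialD.
have zE : exponential zeta x = expi (theta * x).
  rewrite /exponential /zeta; congr expi.
  by move: (@pi R) pi0 => p p0; field.
have zNE : exponential (- zeta) x = expi (- (theta * x)).
  rewrite /exponential /zeta; congr expi.
  by move: (@pi R) pi0 => p p0; field.
rewrite zE zNE rmorphM/= mulrAC.
have -> : (sin (theta * (x - a)))%:C =
    (0 -i* 2^-1) * (expi (- (theta * a)) * expi (theta * x)) +
    (0 +i* 2^-1) * (expi (theta * a) * expi (- (theta * x))).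
  rewrite -!expiD.
  rewrite (_ : - (theta * a) + theta * x = theta * (x - a)); last by ring.
  rewrite (_ : theta * a - theta * x = - (theta * (x - a))); last by ring.
  rewrite /expi cosN sinN; simpc.
  by apply/eqP; rewrite eq_complex/=; apply/andP; split; apply/eqP; lra.
ring.
Qed.

(** Dominated convergence with the constant (M + M)^2, integrable because mu is finite. *)
Lemma tame_lim (F : nat -> R -> R) h (M : R) : (forall n, tame (F n)) ->
  (forall n x, `|F n x| <= M) -> (forall x, F n x @[n --> \oo] --> h x) -> tame h.
Proof.
move=> tF FM Fh.
have hM x : `|h x| <= M.
  apply: (cvgr_to_le (cvg_norm (@Fh x))); by near=> n.
have mh : measurable_fun setT h.
  by apply: (measurable_fun_cvg (h := F)) => [n|x _]; [case: (tF n) | exact: Fh].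
split => //; first by exists M.
move=> eta; apply: (@approximable_dominated
    (fun n x => (F n x)%:C * exponential eta x) _ (fun=> (M + M) ^+ 2)).
- by move=> n; case: (tF n).
- by apply: cmeasurableM; [exact: cmeasurable_real | exact: cmeasurable_exponential].
- exact: finite_measure_integrable_cst.
- move=> n x; rewrite -mulrBl normsqM normsq_exponential mulr1 -rmorphB normsq_real.
  rewrite -real_normK ?num_real// lerXn2r ?nnegrE ?addr_ge0 ?(le_trans _ (hM x))//.
  by apply: le_trans (ler_normB _ _) _; rewrite lerD.
- move=> x; under eq_fun => n.
    rewrite -mulrBl normsqM normsq_exponential mulr1 -rmorphB normsq_real; over.
  rewrite (_ : 0 = (h x - h x) ^+ 2); last by rewrite subrr expr0n.
  apply: (cvg_comp _ (fun y : R => y ^+ 2)); last exact: exprn_continuous.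
  by apply: cvgB; [exact: cvg_cst | exact: Fh].
Unshelve. all: by end_near. Qed.

Lemma tameXn (u : R -> R) :
  (forall h, tame h -> tame (fun x => h x * u x)) ->
  forall n h, tame h -> tame (fun x => h x * u x ^+ n).
Proof.
move=> tu n; elim: n => [|n IH] h th.
  by under eq_fun do rewrite expr0 mulr1.
by under eq_fun do rewrite exprS mulrA; apply: IH; exact: tu.
Qed.

(* For u in [0, 1], the polynomials (1 - u ^ n) ^ (n 2 ^ n) converge to the
   indicator of u < 1/2, by Bernoulli's inequality on both sides. *)
Lemma threshold_cvg (u : R) : 0 <= u <= 1 ->
  (1 - u ^+ n) ^+ (n * 2 ^ n) @[n --> \oo] --> ((u < 2^-1)%R%:R : R).
Proof.
move=> /andP[u0 u1].
have bern (y : R) k : -1 <= y -> 1 + y *+ k <= (1 + y) ^+ k.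
  move=> y1; elim: k => [|k IH]; first by rewrite mulr0n addr0 expr0.
  rewrite exprS; have y10 : 0 <= 1 + y by lra.
  apply: le_trans (ler_wpM2l y10 IH).
  rewrite mulrS -mulr_natr; have t0 : 0 <= k%:R :> R by [].
  have := mulr_ge0 t0 (sqr_ge0 y); nra.
have un n : 0 <= u ^+ n <= 1 by rewrite exprn_ge0// exprn_ile1.
case: ltP => [u2|u2].
- have lo n : 1 - n%:R * (2 * u) ^+ n <= (1 - u ^+ n) ^+ (n * 2 ^ n).
    apply: le_trans (bern (- u ^+ n) (n * 2 ^ n)%N _); last first.
      by have /andP[] := un n; lra.
    rewrite -[in leRHS]mulr_natr natrM natrX exprMn le_eqVlt; apply/orP; left.
    by apply/eqP; ring.
  apply: (squeeze_cvgr (f := fun n => 1 - n%:R * (2 * u) ^+ n) (h := fun=> 1)).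
  + near=> n; rewrite lo/= exprn_ile1//; have /andP[] := un n; lra.
  + rewrite -[X in _ --> X]subr0; apply: cvgB; first exact: cvg_cst.
    (* n r^n = (n s^n) s^n with s the square root of r: the first factor is bounded and the second
       tends to 0. *)
    have r0 : 0 <= 2 * u < 1 by lra.
    set r := 2 * u in r0 *; set s := Num.sqrt r.
    have rs : r = s ^+ 2 by rewrite sqr_sqrtr//; lra.
    have s0 : 0 <= s by exact: sqrtr_ge0.
    have s1 : s < 1 by rewrite -(ltr_pXn2r (n := 2)) ?nnegrE// -rs expr1n; lra.
    have w0 : 0 < 1 - s by lra.
    have ns n : n%:R * s ^+ n <= (1 - s)^-1.
      rewrite -[leRHS]mul1r ler_pdivlMr//.
      (* Here s (2 - s) = 1 - (1 - s)^2 <= 1, while Bernoulli gives (2 - s)^n >= n (1 - s). *)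
      have h1 : s ^+ n * (1 + (1 - s)) ^+ n <= 1.
        rewrite -exprMn exprn_ile1//; have := sqr_ge0 (1 - s); nra.
      apply: le_trans h1; rewrite mulrAC mulrC ler_wpM2l ?exprn_ge0//.
      apply: le_trans (bern (1 - s) n _); last by lra.
      by rewrite -[in leRHS]mulr_natl; lra.
    apply: (squeeze_cvgr (f := fun=> 0) (h := fun n => (1 - s)^-1 * s ^+ n)).
    - near=> n; rewrite mulr_ge0 ?exprn_ge0//=; last by lra.
      by rewrite rs -exprM mul2n -addnn exprD mulrA ler_wpM2r ?exprn_ge0.
    - exact: cvg_cst.
    - rewrite -[X in _ --> X](mulr0 (1 - s)^-1); apply: cvgZr => //.
      by apply: cvg_expr; rewrite ger0_norm.
  + exact: cvg_cst.
(* With K = n 2^n, (1 - v)^K <= (1 + v)^-K, and Bernoulli bounds (1 + v)^K below by 1 + n (2 u)^n >=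
   n + 1. *)
- have hi n : (1 - u ^+ n) ^+ (n * 2 ^ n) <= (n.+1%:R)^-1.
    have /andP[v0 v1] := un n; set v := u ^+ n in v0 v1 *.
    have h1 : (1 - v) ^+ (n * 2 ^ n) * (1 + v) ^+ (n * 2 ^ n) <= 1.
      by rewrite -exprMn exprn_ile1//; nra.
    have h2 : n.+1%:R <= (1 + v) ^+ (n * 2 ^ n).
      apply: le_trans (bern v _ _); last by lra.
      rewrite -natr1 addrC lerD2l -[leRHS]mulr_natr natrM natrX mulrCA ler_peMr//.
      by rewrite -exprMn exprn_ege1// -ler_pdivrMr// mul1r.
    rewrite -[leRHS]mul1r ler_pdivlMr//; apply: le_trans h1.
    by rewrite ler_wpM2l// exprn_ge0//; lra.
  apply: (squeeze_cvgr (f := fun=> 0) (h := fun n => (n.+1%:R)^-1)).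
  + near=> n; rewrite hi andbT exprn_ge0//; have /andP[] := un n; lra.
  + exact: cvg_cst.
  + exact: cvg_harmonic.
Unshelve. all: by end_near. Qed.

(** u = (1 + sin) / 2 lies in [0, 1] and is below 1/2 exactly where the sine is negative, so the
    threshold polynomials in u apply. *)
Lemma tame_threshold theta a h :
  tame h -> tame (fun x => h x * (sin (theta * (x - a)) < 0)%R%:R).
Proof.
move=> th; pose u x := (1 + sin (theta * (x - a))) / 2.
have u01 x : 0 <= u x <= 1.
  have := sin_le1 (theta * (x - a)); have := sin_geN1 (theta * (x - a)).
  by rewrite /u => ? ?; apply/andP; split; lra.
have tu k : tame k -> tame (fun x => k x * u x).
  move=> tg; have := tameD (tameZ 2^-1 tg) (tameZ 2^-1 (tame_sin theta a tg)).
  by congr tame; apply/funext => x; rewrite /u; lra.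
have tun n k : tame k -> tame (fun x => k x * (1 - u x ^+ n)).
  move=> tg; have := tameD tg (tameZ (-1) (tameXn tu n tg)).
  by congr tame; apply/funext => x; ring.
have [_ [M hM] _] := th.
apply: (@tame_lim (fun n x => h x * (1 - u x ^+ n) ^+ (n * 2 ^ n)) _ M).
- by move=> n; exact: (tameXn (tun n)).
- move=> n x; rewrite normrM; apply: le_trans (hM x); rewrite ler_piMr//.
  have /andP[u0 u1] := u01 x.
  have h1 : 0 <= u x ^+ n <= 1 by rewrite exprn_ge0// exprn_ile1.
  rewrite ger0_norm ?exprn_ge0 ?exprn_ile1//; by move/andP: h1 => [? ?]; lra.
- move=> x; have -> : (sin (theta * (x - a)) < 0) = (u x < 2^-1).
    by rewrite /u; apply/idP/idP => ?; lra.
  by apply: cvgM; [exact: cvg_cst | exact: threshold_cvg].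
Qed.

(** For large j the point (x - a) / (j + 1) lies in ]-1, 1[, where the sine has the sign of its
    argument. *)
Lemma tame_ray a h : tame h -> tame (fun x => h x * (x < a)%R%:R).
Proof.
move=> th; have [_ [M hM] _] := th.
apply: (@tame_lim (fun j x => h x * (sin (j.+1%:R^-1 * (x - a)) < 0)%R%:R) _ M).
- by move=> j; exact: tame_threshold.
- move=> j x; rewrite normrM; apply: le_trans (hM x); rewrite ler_piMr//.
  by case: (_ < 0); rewrite ?normr1 ?normr0.
move=> x; apply: cvg_near_cst; near=> j; congr (_ * _%:R); congr nat_of_bool.
have xj : `|x - a| < j.+1%:R.
  apply: lt_le_trans (truncnS_gt _) _; rewrite ler_nat ltnS.
  by near: j; exact: nbhs_infty_ge.
have j0 : 0 < j.+1%:R :> R by rewrite ltr0n.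
have ppi : 1 < pi :> R by apply: lt_le_trans (pi_ge2 R); rewrite ltr1n.
set y := _ * (x - a).
have y1 : `|y| < 1.
  by rewrite /y normrM normfV (gtr0_norm j0) mulrC ltr_pdivrMr// mul1r.
have yE : (y < 0) = (x < a) by rewrite /y pmulr_rlt0 ?invr_gt0// subr_lt0.
rewrite -yE; move: y1; rewrite ltr_norml => /andP[y1 y2].
have [y0|y0|->] := ltgtP y 0.
- by rewrite -oppr_gt0 -sinN; apply: sin_gt0_pi; lra.
- by apply/negbTE; rewrite -leNgt ltW//; apply: sin_gt0_pi; lra.
- by rewrite sin0 ltxx.
Unshelve. all: by end_near. Qed.

(** The sets whose indicator preserves tameness form a sigma-algebra containing the rays ]-oo, a[,
    hence all Borel sets. *)
Lemma tame_indic (A : set R) h :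
  measurable A -> tame h -> tame (fun x => h x * \1_A x).
Proof.
move=> mA; move: h; pose S : set (set R) :=
  [set A : set R | forall h, tame h -> tame (fun x => h x * \1_A x)].
suff : S A by [].
have SC B : S B -> S (~` B).
  move=> SB h th; have := tameD th (tameZ (-1) (SB _ th)); congr tame.
  apply/funext => x; rewrite !indicE in_setC; case: (x \in B) => /=; ring.
have Srays : @RGenInftyO.G R `<=` S.
  move=> _ [a ->] h th; have := tame_ray a th; congr tame.
  apply/funext => x; rewrite indicE; congr (_ * _%:R); congr nat_of_bool.
  by apply/idP/idP => [xa|/set_mem]; [apply/mem_set; rewrite /= in_itv | rewrite /= in_itv].
have Ssigma : sigma_algebra setT S.
  split.
  - move=> h th; have := tameZ 0 th; congr tame; apply/funext => x.
    by rewrite indic0 mulr0 mul0r.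
  - by move=> B SB; rewrite setTD; exact: SC.
  (* A union is the complement of an intersection, whose indicator is the limit of finite
     products. *)
  - move=> F SF; rewrite -[X in S X]setCK; apply: (SC) => h th.
    have [_ [M hM] _] := th.
    apply: (@tame_lim (fun n x => h x * \prod_(i < n) \1_(~` F i) x) _ M).
    + move=> n; elim: n h th {hM} => [|n IH] h th.
        by under eq_fun do rewrite big_ord0 mulr1.
      under eq_fun do rewrite big_ord_recr/= mulrA.
      by apply: (SC _ (SF n)); exact: IH.
    + move=> n x; rewrite normrM; apply: le_trans (hM x); rewrite ler_piMr//.
      rewrite ger0_norm ?prodr_ge0// prodr_ile1// => i _.
      by rewrite indicE lern1 leq_b1 ler0n.
    + move=> x; have [[k _ Fkx]|nF] := pselect ((\bigcup_k F k) x).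
        apply: cvg_near_cst; near=> n; congr (_ * _).
        have kn : (k < n)%N by near: n; exact: nbhs_infty_gt.
        have F0 : \1_(~` F k) x = 0 :> R by rewrite indicE memNset// => /(_ Fkx).
        rewrite (bigD1 (Ordinal kn))//= F0 mul0r indicE memNset// => nF.
        by apply: nF; exists k.
      apply: cvg_near_cst; near=> n; congr (_ * _); rewrite indicE.
      rewrite mem_set// big1// => i _; rewrite indicE mem_set// => Fix.
      by apply: nF; exists i.
have mA' : (@RGenInftyO.G R).-sigma.-measurable A.
  by rewrite -RGenInftyO.measurableE; exact: mA.
exact: (smallest_sub Ssigma Srays mA').
Unshelve. all: by end_near. Qed.

Lemma approximable_indic (A : set R) :
  measurable A -> approximable (fun x => (\1_A x)%:C).
Proof.
move=> mA; have [_ _ /(_ 0)] := tame_indic mA tame1; congr approximable.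
by apply/funext => x; rewrite exponential0 mulr1 mul1r.
Qed.

Import HBNNSimple.

(** Simple functions increase to h, and h^2 dominates the squared errors. *)
Lemma approximable_ge0 h : measurable_fun setT h -> (forall x, 0 <= h x) ->
  mu.-integrable setT (fun x => (h x ^+ 2)%:E) -> approximable (fun x => (h x)%:C).
Proof.
move=> mh h0 ih.
have mhE : measurable_fun setT (EFin \o h) by exact/measurable_EFinP.
have hE0 x : setT x -> (0 <= (EFin \o h) x)%E by rewrite /= lee_fin.
pose F := nnsfun_approx measurableT mhE.
have Fh x : F n x @[n --> \oo] --> h x.
  by have /fine_cvgP[_] := cvg_nnsfun_approx measurableT mhE hE0 (I : setT x).
have Fle n x : F n x <= h x.
  rewrite -(cvg_lim _ (Fh x))//; apply: (nondecreasing_cvgn_le (u_ := F ^~ x)).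
    by move=> i j ij; exact/lefP/nd_nnsfun_approx.
  by apply/cvg_ex; exists (h x); exact: Fh.
apply: (@approximable_dominated (fun n x => (F n x)%:C) _ (fun x => h x ^+ 2)) => //.
- move=> n.
  rewrite (_ : (fun x => _) = (fun x => \sum_(y <- fset_set (range (F n)))
      y%:C * (\1_(F n @^-1` [set y]) x)%:C)); last first.
    apply/funext => x; rewrite fimfunE fsbig_finite//= rmorph_sum/=.
    by apply: eq_bigr => y _; rewrite rmorphM.
  apply: approximable_sum => y; apply: approximableZ; apply: approximable_indic.
  exact: measurable_funPTI.
- move=> n x; rewrite -rmorphB normsq_real lerXn2r ?nnegrE ?subr_ge0//.
  by rewrite lerBlDr lerDl.
- move=> x; under eq_fun do rewrite -rmorphB normsq_real.
  rewrite (_ : 0 = (h x - h x) ^+ 2); last by rewrite subrr expr0n.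
  apply: (cvg_comp _ (fun y : R => y ^+ 2)); last exact: exprn_continuous.
  by apply: cvgB; [exact: cvg_cst | exact: Fh].
Qed.

Lemma approximable_real h : measurable_fun setT h ->
  mu.-integrable setT (fun x => (h x ^+ 2)%:E) -> approximable (fun x => (h x)%:C).
Proof.
move=> mh ih.
have mp : measurable_fun setT (fun x => Num.max (h x) 0) by exact: measurable_maxr.
have mn : measurable_fun setT (fun x => Num.max (- h x) 0).
  by apply: measurable_maxr => //; exact: measurableT_comp.
have int_le (k : R -> R) : measurable_fun setT k -> (forall x, k x ^+ 2 <= h x ^+ 2) ->
    mu.-integrable setT (fun x => (k x ^+ 2)%:E).
  move=> mk kh; apply: (le_integrable _ _ _ ih) => //.
    by apply/measurable_EFinP; exact: measurable_funX.
  by move=> x _; rewrite !abse_EFin lee_fin !ger0_norm ?sqr_ge0.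
rewrite (_ : (fun x => _) = (fun x => (Num.max (h x) 0)%:C +
    (-1) * (Num.max (- h x) 0)%:C)); last first.
  apply/funext => x; rewrite mulN1r -rmorphN -rmorphD; congr (_%:C).
  by rewrite /Order.max; case: (ltP (h x) 0); case: (ltP (- h x) 0) => ? ?; lra.
apply: approximableD; last apply: approximableZ; apply: approximable_ge0 => //.
- by move=> x; rewrite le_max lexx orbT.
- apply: int_le => // x; rewrite /Order.max; case: ltP => // _.
  by rewrite expr0n sqr_ge0.
- by move=> x; rewrite le_max lexx orbT.
- apply: int_le => // x; rewrite /Order.max; case: ltP => // _.
    by rewrite expr0n sqr_ge0.
  by rewrite sqrrN.
Qed.

Theorem approximable_L2 f : inL2 mu f -> approximable f.
Proof.
move=> [[mre mim] /L2norm_fin fin].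
have mf : cmeasurable f by [].
have isq : mu.-integrable setT (fun x => (normsq (f x))%:E).
  apply/integrableP; split; first exact: measurable_normsqE.
  apply: le_lt_trans fin; rewrite /L2sq le_eqVlt; apply/orP; left; apply/eqP.
  by apply: eq_integral => x _; rewrite abse_EFin ger0_norm ?normsq_ge0.
have int_le (k : R -> R) : measurable_fun setT k ->
    (forall x, k x ^+ 2 <= normsq (f x)) -> mu.-integrable setT (fun x => (k x ^+ 2)%:E).
  move=> mk kh; apply: (le_integrable _ _ _ isq) => //.
    by apply/measurable_EFinP; exact: measurable_funX.
  move=> x _; rewrite !abse_EFin lee_fin !ger0_norm ?sqr_ge0 ?normsq_ge0//.
rewrite (_ : f = (fun x => (complex.Re (f x))%:C + (0 +i* 1) * (complex.Im (f x))%:C)).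
  apply: approximableD; last apply: approximableZ; apply: approximable_real => //.
    by apply: int_le => // x; rewrite lerDl sqr_ge0.
  by apply: int_le => // x; rewrite lerDr sqr_ge0.
by apply/funext => x; case: (f x) => a b; simpc.
Qed.

End Density.

(** * The Fourier transform *)

Lemma big_imfset_seq (V : nmodType) (K T : choiceType) (f : T -> K) (s : seq T)
    (G : K -> V) : injective f -> uniq s ->
  \sum_(i <- [fset f x | x in s]%fset) G i = \sum_(x <- s) G (f x).
Proof.
move=> f_inj us; rewrite -(big_map f xpredT); apply: perm_big.
apply: uniq_perm; rewrite ?fset_uniq ?map_inj_uniq// => x.
by apply/imfsetP/mapP => -[y ys ->]; exists y.
Qed.

Section FourierTransform.
Variables (R : realType) (mu : probability R R).
Implicit Types (eta zeta x : R) (z w : R[i]).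

Definition fourier zeta : R[i] := cintegral mu (exponential zeta).

Lemma normsq_fourier zeta : normsq (fourier zeta) = fourier_sq mu zeta.
Proof. by []. Qed.

Lemma integrable_trig (f : R -> R) : continuous f -> (forall x, `|f x| <= 1) ->
  mu.-integrable setT (EFin \o f).
Proof.
move=> cf f1; apply: (@le_integrable _ _ _ mu setT _ _ (cst 1%E)) => //.
- by apply/measurable_EFinP; exact: continuous_measurable_fun.
- by move=> y _; rewrite /= lee_fin normr1.
- exact: finite_measure_integrable_cst.
Qed.

Lemma integrable_cos zeta :
  mu.-integrable setT (EFin \o (fun x => cos (2 * pi * zeta * x))).
Proof.
apply: integrable_trig => x; last exact: cos_max.
by apply: continuous_comp; [exact: mulrl_continuous | exact: continuous_cos].
Qed.

Lemma integrable_sin zeta :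
  mu.-integrable setT (EFin \o (fun x => sin (2 * pi * zeta * x))).
Proof.
apply: integrable_trig => x; last exact: sin_max.
by apply: continuous_comp; [exact: mulrl_continuous | exact: continuous_sin].
Qed.

Lemma integrable_Re_exponential z zeta :
  mu.-integrable setT (fun x => (complex.Re (z * exponential zeta x))%:E).
Proof.
rewrite (_ : (fun x => _) = (fun x =>
    (complex.Re z)%:E * (cos (2 * pi * zeta * x))%:E -
    (complex.Im z)%:E * (sin (2 * pi * zeta * x))%:E)%E).
  apply: integrableB => //; apply: integrableZl => //.
    exact: integrable_cos.
  exact: integrable_sin.
by apply/funext => x; case: z.
Qed.

Lemma integral_Re_exponential z zeta :
  (\int[mu]_x (complex.Re (z * exponential zeta x))%:E =
   (complex.Re (z * fourier zeta))%:E)%E.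
Proof.
transitivity (\int[mu]_x ((complex.Re z)%:E * (cos (2 * pi * zeta * x))%:E -
    (complex.Im z)%:E * (sin (2 * pi * zeta * x))%:E))%E.
  by apply: eq_integral => x _; case: z.
have ic := integrable_cos zeta; have isn := integrable_sin zeta.
rewrite integralB//; try by apply: integrableZl.
rewrite !integralZl// /fourier /cintegral.
rewrite -[X in (_ * X - _)%E]fineK ?(integrable_fin_num _ ic)//.
rewrite -[X in (_ - _ * X)%E]fineK ?(integrable_fin_num _ isn)//.
by case: z.
Qed.

Lemma fourierN zeta : fourier (- zeta) = (fourier zeta)^*.
Proof.
rewrite /fourier /cintegral /=; congr (_ +i* _).
  by apply: eq_Rintegral => x _; rewrite mulrN mulNr cosN.
under eq_Rintegral do rewrite mulrN mulNr sinN -mulN1r.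
by rewrite RintegralZl ?mulN1r//; exact: integrable_sin.
Qed.

Lemma fourier0 : fourier 0 = 1.
Proof.
rewrite /fourier /cintegral /=; congr (_ +i* _).
  under eq_Rintegral do rewrite mulr0 mul0r cos0.
  by rewrite Rintegral_cst// mul1r; exact: (congr1 fine (@probability_setT _ _ _ mu)).
under eq_Rintegral do rewrite mulr0 mul0r sin0.
by rewrite Rintegral_cst// mul0r.
Qed.

Lemma conjc_exponential zeta x : (exponential zeta x)^* = exponential (- zeta) x.
Proof. by rewrite /exponential conjc_expi; congr expi; ring. Qed.

(** The sum times its conjugate expands into exponentials at differences of frequencies, which
    integrate to Fourier transforms. *)
Lemma L2sq_exponential_sum (s : seq (R[i] * R)) :
  L2sq mu (fun x => \sum_(p <- s) p.1 * exponential p.2 x) =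
  (\sum_(p <- s) \sum_(r <- s)
    complex.Re (p.1 * r.1^* * fourier (p.2 - r.2)))%:E.
Proof.
transitivity (\int[mu]_x (\sum_(p <- s) \sum_(r <- s)
    (complex.Re (p.1 * r.1^* * exponential (p.2 - r.2) x))%:E))%E.
  apply: eq_integral => x _.
  under [RHS]eq_bigr do rewrite sumEFin.
  rewrite [RHS]sumEFin; congr EFin.
  set T := \sum_(p <- s) _.
  transitivity (complex.Re (T * T^*)).
    by rewrite /normsq; case: T => a b /=; ring.
  rewrite /T rmorph_sum/= mulr_suml raddf_sum/=; apply: eq_bigr => p _.
  rewrite mulr_sumr raddf_sum/=; apply: eq_bigr => r _.
  rewrite rmorphM/= -[X in _ * (_ * X)]/((exponential r.2 x)^*) conjc_exponential.
  by rewrite mulrACA exponentialD.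
rewrite integral_sum//; last first.
  by move=> p; apply: integrable_sum => // r _; exact: integrable_Re_exponential.
rewrite -sumEFin; apply: eq_bigr => p _.
rewrite integral_sum//; last by move=> r; exact: integrable_Re_exponential.
rewrite -sumEFin; apply: eq_bigr => r _; exact: integral_Re_exponential.
Qed.

Lemma normsq_eq0 z : normsq z = 0 -> z = 0.
Proof.
move=> /eqP; rewrite /normsq paddr_eq0 ?sqr_ge0// !sqrf_eq0.
by case: z => a b /= /andP[/eqP -> /eqP ->].
Qed.

Lemma Re_mulJ z : complex.Re (z * z^*) = normsq z.
Proof. by case: z => a b; rewrite /normsq/=; ring. Qed.

Local Arguments complex.Re : simpl never.

(** Squared distance from the exponential at eta to its orthogonal projection on the span of S; the
    coefficient [fourier (eta - l)] is its inner product with the exponential at l. *)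
Lemma bessel_defect (S : seq R) eta : uniq S ->
  (forall l l', l \in S -> l' \in S -> l != l' -> fourier_sq mu (l - l') = 0) ->
  L2sq mu (fun x => exponential eta x -
    \sum_(l <- S) fourier (eta - l) * exponential l x) =
  (1 - \sum_(l <- S) fourier_sq mu (eta - l))%:E.
Proof.
move=> uS S_orth.
pose s := (1, eta) :: [seq (- fourier (eta - l), l) | l <- S].
rewrite (_ : (fun x => _) = (fun x => \sum_(p <- s) p.1 * exponential p.2 x)); last first.
  apply/funext => x; rewrite /s big_cons big_map/= mul1r -sumrN.
  by congr (_ + _); apply: eq_bigr => l _; rewrite mulNr.
rewrite L2sq_exponential_sum /s !big_cons !big_map/=; congr EFin.
rewrite subrr fourier0 rmorph1 !mul1r.
have -> : \sum_(l <- S) complex.Re (1 * (- fourier (eta - l))^* * fourier (eta - l)) =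
    - \sum_(l <- S) fourier_sq mu (eta - l).
  rewrite -sumrN; apply: eq_bigr => l _; rewrite -normsq_fourier -Re_mulJ.
  by rewrite mul1r rmorphN/= mulNr raddfN/= mulrC.
rewrite [X in _ + X = _](_ : _ = 0) ?addr0//.
(* In row l the eta term and the diagonal term cancel, and the others vanish by orthogonality. *)
apply: big1_seq => l /andP[_ lS]; rewrite big_cons big_map/= rmorph1 mulr1.
rewrite (bigD1_seq l)//= big1_seq ?addr0.
  rewrite subrr fourier0 mulr1 rmorphN/= mulrNN -/(conjc _) Re_mulJ.
  rewrite mulNr raddfN/= -[l - eta]opprB fourierN Re_mulJ; ring.
move=> l' /andP[l'l l'S].
rewrite (normsq_eq0 (z := fourier (l - l'))) ?mulr0//.
by rewrite normsq_fourier S_orth// eq_sym.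
Qed.

End FourierTransform.

(** * The main theorem *)

Lemma fourier_sqN (R : realType) (mu : probability R R) (x : R) :
  fourier_sq mu (- x) = fourier_sq mu x.
Proof.
rewrite -!normsq_fourier fourierN; case: (fourier mu x) => a b.
by rewrite /normsq/= sqrrN.
Qed.

(** The spectrum is the union of the [Lam k]. By [bessel_defect] the last hypothesis puts every
    exponential in the closed span, and [approximable_L2] then reaches all of L2. *)
Theorem spectral_of_nested (R : realType) (mu : probability R R)
    (Lam : nat -> seq int) :
  (forall k, uniq (Lam k)) ->
  (forall k j, (k <= j)%N -> {subset Lam k <= Lam j}) ->
  (forall k l l', l \in Lam k -> l' \in Lam k -> l != l' ->
    fourier_sq mu (l'%:~R - l%:~R) = 0) ->
  (forall x eps, 0 < eps ->
    exists k, 1 - eps <= \sum_(l <- Lam k) fourier_sq mu (x + l%:~R)) ->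
  spectral_measure mu.
Proof.
move=> uL nL oL cL; have intr_injR : injective (fun l : int => l%:~R : R).
  exact: intr_inj.
pose freq k : {fset R} := [fset l%:~R | l in Lam k]%fset.
pose Lambda : set R := \bigcup_k [set` freq k].
have oF x y : Lambda x -> Lambda y -> x != y -> fourier_sq mu (x - y) = 0.
  move=> [i _ /imfsetP[l /= li ->]] [j _ /imfsetP[l' /= l'j ->]] ll'.
  apply: (oL (maxn i j)); last by apply: contraNneq ll' => ->.
  - by apply: nL l'j; exact: leq_maxr.
  - by apply: nL li; exact: leq_maxl.
exists Lambda; split; first by apply: bigcup_countable => // k _; exact: countable_fset.
have L2e x : inL2 mu (exponential x).
  split; first exact: cmeasurable_exponential.
  apply: L2sq_fin; rewrite /L2sq; under eq_integral do rewrite normsq_exponential.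
  by rewrite integral_cst//= mul1e fin_num_fun_lty//; exact: fin_num_measure.
split => [x _|x y Lx Ly|f fL2 eps eps0]; first exact: L2e.
- have -> : L2inner mu (exponential x) (exponential y) = fourier mu (x - y).
    rewrite /L2inner /fourier; congr (cintegral mu _); apply/funext => u.
    rewrite -[LHS]/(exponential x u * conjc (exponential y u)).
    by rewrite conjc_exponential exponentialD.
  have [->|xy] := eqVneq x y; first by rewrite subrr fourier0.
  by apply: normsq_eq0; rewrite normsq_fourier oF.
have app_exp eta : approximable mu Lambda (exponential eta).
  split; first exact: cmeasurable_exponential.
  move=> e e0; have e2 : 0 < e / 2 by rewrite divr_gt0.
  (* Taken at - eta because the defect involves eta - l; [fourier_sq] is even. *)
  have [k hk] := cL (- eta) _ e2.
  exists (fun x => \sum_(l <- freq k) fourier mu (eta - l) * exponential l x).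
    exists (freq k), (fun l => fourier mu (eta - l)); split => //.
    by move=> x xk; exists k.
  rewrite bessel_defect ?fset_uniq//; last first.
    by move=> l l' lk l'k; apply: oF; exists k.
  rewrite lte_fin big_imfset_seq//.
  under eq_bigr do rewrite -fourier_sqN opprB addrC.
  lra.
have [_ /(_ (eps ^+ 2))] := approximable_L2 app_exp fL2.
move=> /(_ (exprn_gt0 _ eps0))[g [s [c [sD ->]]] fg].
by exists s, c; split => //; exact: L2norm_lt.
Qed.

(** * The rescaled digit sets *)

Section DigitSets.
Variables (R : realType) (m : nat) (N : 'I_m -> int) (B L : 'I_m -> {fset int}).
Variables (n : nat -> nat) (omega : nat -> 'I_m).
Hypothesis hadamard : forall j, hadamard_triple R (N j) (B j) (L j).
Hypothesis n_gt0 : forall k, (0 < n k)%N.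

Let A := digit_set R N B n omega.
Let c k : R := \prod_(i < k.+1) (N (omega i))%:~R ^- n i.

Lemma scale_neq0 k : c k != 0.
Proof.
rewrite /c prodf_seq_neq0; apply/allP => i _ /=.
rewrite invr_eq0 expf_eq0 negb_and orbC intr_eq0.
by have [h _ _ _] := hadamard (omega i); apply/orP; left; lia.
Qed.

Lemma digit_inj k : injective (fun b : int => c k * b%:~R).
Proof. by move=> b b' /(mulfI (scale_neq0 k))/intr_inj. Qed.

Lemma card_digit_set k : #|` A k| = #|` B (omega k)|.
Proof. by rewrite /A /digit_set card_imfset//; exact: digit_inj. Qed.

Lemma digit_set_mask k x : fset_mask (A k) x = mask (B (omega k)) (x * c k).
Proof.
rewrite /fset_mask /mask card_digit_set /A /digit_set.
rewrite !big_imfset /=; [|by move=> ? ? _ _; exact: digit_inj..].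
by congr ((_ ^+ 2 + _ ^+ 2) / _); apply: eq_bigr => b _; congr (_ _);
  rewrite -/(c k); ring.
Qed.

(** Every factor of the scale is at most 1/2 in modulus since |N_j| >= 2 and n_i >= 1; D, the sum of
    all |b|, dominates each digit. *)
Lemma digit_set_bound :
  exists D : R, forall k a, a \in A k -> `|a| <= D / 2 ^+ k.
Proof.
pose D : R := \sum_(j < m) \sum_(b <- B j) `|b%:~R|.
exists D => k _ /imfsetP[b /= bB ->].
rewrite normrM mulrC ler_pM//.
  rewrite /D (bigD1 (omega k))//= (bigD1_seq b)//= ?fset_uniq//.
  rewrite -addrA lerDl addr_ge0 ?sumr_ge0// => i _; exact: sumr_ge0.
rewrite normr_prod -exprVn.
have h i : `|(N (omega i))%:~R ^- n i| <= 2^-1 :> R.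
  rewrite normfV normrX lef_pV2 ?posrE//; last first.
    rewrite exprn_gt0// normr_gt0 intr_eq0.
    by have [? _ _ _] := hadamard (omega i); lia.
  have N2 : 2 <= `|(N (omega i))%:~R| :> R.
    by rewrite -intr_norm (ler_int _ 2); have [] := hadamard (omega i).
  rewrite (le_trans N2)// ler_eXnr ?n_gt0//.
  by apply: le_trans N2; rewrite ler1n.
rewrite big_ord_recr/= -[leRHS]mulr1 ler_pM ?prodr_ge0//.
  apply: (@le_trans _ _ (\prod_(i < k) (2^-1 : R))).
    by apply: ler_prod => i _; rewrite normr_ge0/=.
  by rewrite prodr_const card_ord.
by apply: le_trans (h k) _; rewrite invf_le1// ler1n.
Qed.

End DigitSets.

(** The infinite convolution enters through a predicate, so its existence is proved beside the
    spectrality of every measure satisfying it. *)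
Theorem theorem1p1 (R : realType) (m : nat) (hm : (1 <= m)%N)
    (N : 'I_m -> int) (B L : 'I_m -> {fset int})
    (hadamard : forall j, hadamard_triple R (N j) (B j) (L j))
    (gcd1 : forall j, gcd_fset (diff_fset (B j)) = 1)
    (n : nat -> nat) (n_gt0 : forall k, (0 < n k)%N)
    (omega : nat -> 'I_m) :
  (exists mu : probability R R,
     is_infinite_convolution (digit_set R N B n omega) mu) /\
  (forall mu : probability R R,
     is_infinite_convolution (digit_set R N B n omega) mu ->
     spectral_measure mu).
Proof.
have [D hD] := digit_set_bound omega hadamard n_gt0.
have A0 k : (0 < #|` digit_set R N B n omega k|)%N.
  rewrite (card_digit_set n omega hadamard); have [_ _ h _] := hadamard (omega k).
  exact: ltnW.
split => [|mu Amu]; first exact: (infinite_convolution_exists A0 hD).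
have F_lim (x : R) : moran_mask N B n omega k x @[k --> \oo] --> fourier_sq mu x.
  (* [moran_mask k] has k factors and the partial convolution of index k has k + 1, hence the
     shift. *)
  rewrite -cvg_shiftS; have := cvg_fourier_sq Amu (x := x).
  apply: cvg_trans; apply: near_eq_cvg; near=> k; apply: eq_bigr => i _.
  by rewrite (digit_set_mask n omega hadamard).
have [Lam [uL nL oL cL]] := moran_spectrum hadamard gcd1 n_gt0 F_lim.
exact: (spectral_of_nested uL nL oL cL).
Unshelve. all: by end_near. Qed.
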